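(* Let $p$ be an odd prime and $r\ge3$ with $p\nmid r$. Let $\mathcal{M}$ be a $G$-rotary augmented PX map of length $r$. Then $\mathcal{M}\cong\mathcal{M}_1\times\cdots\times\mathcal{M}_k$, where each $\mathcal{M}_i$ is an irreducible $G_i$-rotary augmented PX map of length $r$ with $G_i=\mathbb{Z}_p^{d_i}\rtimes\mathrm{D}_{2r}$, and $\mathcal{M}_i\not\cong\mathcal{M}_j$ for $1\le i\ne j\le k$. Moreover, this decomposition is unique up to isomorphism (and reordering of factors), and $G\cong(\mathbb{Z}_p^{d_1}\times\cdots\times\mathbb{Z}_p^{d_k})\rtimes\mathrm{D}_{2r}$.
   Context: A map is a 2-cell embedding of a connected graph (multiple edges allowed, no loops) in a closed orientable surface. For $G\le\mathrm{Aut}(\mathcal{M})$, $\mathcal{M}$ is $G$-rotary if $G$ is regular on arcs with cyclic vertex and face stabilizers; then $\mathcal{M}\cong\mathsf{RotaMap}(G,\rho,\tau)$ for some $\rho,\tau$ with $G=\langle\rho,\tau\rangle$, $|\tau|=2$, where $\mathsf{RotaMap}(G,\rho,\tau)$ has vertices, edges, faces the left cosets of $\langle\rho\rangle,\langle\tau\rangle,\langle\rho\tau\rangle$, incidence being nonempty intersection. Direct product: for $\mathcal{M}_i=\mathsf{RotaMap}(G_i,\rho_i,\tau_i)$ and $H=\langle(\rho_1,\dots,\rho_n),(\tau_1,\dots,\tau_n)\rangle\le\prod G_i$, $\prod\mathcal{M}_i=\mathsf{RotaMap}(H,(\rho_i)_i,(\tau_i)_i)$. Augmented PX graph of length $r$: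 for $s\ge1$, the graph with vertex set $\mathbb{Z}_r\times\mathbb{Z}_p^s$ and edges $\{(i,x_0,\dots,x_{s-1}),(i+1,x_1,\dots,x_s)\}$; the cycle of length $r$ with $p$ parallel edges between adjacent vertices; or the cycle $\mathrm{C}_{pr}$. An augmented PX map of length $r$ is a map with such an underlying graph; a $G_i$-rotary one is irreducible if $G_i\cong\mathbb{Z}_p^{d_i}\rtimes_\psi\mathrm{D}_{2r}$ with $\psi$ irreducible over $\mathbb{F}_p$. *)

(* Defs.v *)
From HB Require Import structures.
From mathcomp Require Import all_boot all_order all_fingroup all_solvable.
Set Implicit Arguments. Unset Strict Implicit. Unset Printing Implicit Defensive.

Local Open Scope group_scope.

Record rdata := RData {
  rgT : finGroupType;
  rG : {group rgT};
  rrho : rgT;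
  rtau : rgT }.
Arguments rG : clear implicits.
Arguments rrho : clear implicits.
Arguments rtau : clear implicits.

Definition is_rotary (D : rdata) : Prop :=
  (rG D : {set rgT D}) = <<[set rrho D; rtau D]>> /\ #[rtau D] = 2%N.

(* Multigraphs given by an incidence relation (vertex type V, edge     *)
(* type E); the underlying graph of RotaMap(G,rho,tau) has vertices    *)
(* the left cosets of <rho>, edges the left cosets of <tau>, incidence *)
(* = nonempty intersection.  [rota_graph_iso D inc] says this graph is *)
(* isomorphic to the multigraph (V, E, inc).                           *)
Definition rota_graph_iso (D : rdata) (V E : finType) (inc : V -> E -> bool)
  : Prop :=
  exists (fv : {set rgT D} -> V) (fe : {set rgT D} -> E),
    [/\ {in lcosets <[rrho D]> (rG D) &, injective fv},
        fv @: lcosets <[rrho D]> (rG D) = [set: V],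
        {in lcosets <[rtau D]> (rG D) &, injective fe},
        fe @: lcosets <[rtau D]> (rG D) = [set: E] &
        {in lcosets <[rrho D]> (rG D), forall A,
         {in lcosets <[rtau D]> (rG D), forall B,
           inc (fv A) (fe B) = (A :&: B != set0)}}].

(* Augmented PX graph, case s >= 1: vertices Z_r x Z_p^s, edges        *)
(* indexed by (i, x_0, ..., x_s), joining (i, x_0..x_{s-1}) and         *)
(* (i+1, x_1..x_s).                                                     *)
Definition PXV (p r s : nat) := ('I_r * {ffun 'I_s -> 'I_p})%type.
Definition PXE (p r s : nat) := ('I_r * {ffun 'I_s.+1 -> 'I_p})%type.
Definition PXinc (p r s : nat) (v : PXV p r s) (e : PXE p r s) : bool :=
  ((v.1 == e.1) && [forall j : 'I_s, v.2 j == e.2 (widen_ord (leqnSn s) j)])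
  || ((v.1 == ordS e.1) && [forall j : 'I_s, v.2 j == e.2 (lift ord0 j)]).

Definition MCinc (p r : nat) (v : 'I_r) (e : ('I_r * 'I_p)%type) : bool :=
  (v == e.1) || (v == ordS e.1).

Definition Cinc (n : nat) (v : 'I_n) (e : 'I_n) : bool :=
  (v == e) || (v == ordS e).

Definition is_aug_PX (p r : nat) (D : rdata) : Prop :=
  (exists s, (1 <= s)%N /\ rota_graph_iso D (@PXinc p r s))
  \/ rota_graph_iso D (@MCinc p r)
  \/ rota_graph_iso D (@Cinc (p * r)).

Definition irred_d (p r d : nat) (D : rdata) : Prop :=
  exists N K : {group rgT D},
    [/\ N ><| K = rG D, p.-abelem N, #|N| = (p ^ d)%N,
        K \isog 'D_(2 * r) & acts_irreducibly K N 'J].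

Definition irreducible_aug_PX (p r : nat) (D : rdata) : Prop :=
  [/\ is_rotary D, is_aug_PX p r D & exists d, irred_d p r d D].

(* Combinatorial (oriented) maps in dart form: darts in a subset of a  *)
(* finite type, rotation [crot] and edge-involution [cedge].           *)
Record cmap := CMap {
  dart : finType;
  darts : {set dart};
  crot : dart -> dart;
  cedge : dart -> dart }.
Arguments darts : clear implicits.
Arguments crot : clear implicits.
Arguments cedge : clear implicits.

Definition cmap_iso (M N : cmap) : Prop :=
  exists f : dart M -> dart N,
    [/\ {in darts M &, injective f},
        f @: darts M = darts N,
        {in darts M, forall x, f (crot M x) = crot N (f x)} &
        {in darts M, forall x, f (cedge M x) = cedge N (f x)}].

(* RotaMap(G, rho, tau) in dart form: darts = G, vertex rotation        *)
(* g |-> g rho, edge involution g |-> g tau (vertices = g<rho>, edges   *)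
(* = g<tau>, faces = g<rho tau>).                                       *)
Definition rota_cmap (D : rdata) : cmap :=
  @CMap (rgT D) (rG D) (fun g => g * rrho D) (fun g => g * rtau D).

(* Direct product prod_i RotaMap(G_i, rho_i, tau_i)                     *)
(*   = RotaMap(H, (rho_i)_i, (tau_i)_i), H = <(rho_i)_i, (tau_i)_i>:     *)
(* H is realised as the set of tuples reachable from (1,...,1) by right *)
(* multiplication by (rho_i)_i and (tau_i)_i (= the generated subgroup  *)
(* of prod_i G_i, as everything is finite).                              *)
Section Product.
Variables (k : nat) (Ms : 'I_k -> rdata).
Definition ptype : finType := {dffun forall i : 'I_k, (rgT (Ms i) : finType)}.
Definition pmul (x y : ptype) : ptype := [ffun i => (x i : rgT (Ms i)) * y i].
Definition prho : ptype := [ffun i => rrho (Ms i)].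
Definition ptau : ptype := [ffun i => rtau (Ms i)].
Definition pone : ptype := [ffun i => 1 : rgT (Ms i)].
Definition pstep : rel ptype :=
  fun x y => (y == pmul x prho) || (y == pmul x ptau).
Definition pH : {set ptype} := [set x | connect pstep pone x].
Definition prod_cmap : cmap :=
  @CMap ptype pH (fun x => pmul x prho) (fun x => pmul x ptau).
End Product.

(* Main.v *)
(* Write z = rho^2.  The graph hypothesis forces G to have a normal elementary
   abelian p-subgroup P of index 2r that is the normal closure of z: rho has
   to exchange the forward and the backward edges at each vertex, so G acts on
   the r levels as D_2r, and the kernel P of this action acts on each
   coordinate of Z_p^s as a p-subgroup of Sym(p), hence through Z_p.  (For
   C_4[p K_1] = K_{2p,2p} the two sides of a vertex cannot be told apart; there
   C(z) has index at most 2 in the subgroup of index 2 preserving the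
   bipartition, so that all p-elements commute with z and with z^tau.)

   With h = rho^p and c = tau h, P is a cyclic F_p[<c>]-module generated by z,
   so its G-invariant subgroups form a distributive lattice.  By Maschke, P is
   then the irredundant direct product of the P / L, with L running over all
   maximal G-invariant proper subgroups; the factors of any decomposition are
   the maps of the G / L.  Conversely such a quotient of order 2r p^(s+1) has
   the PX graph with parameter s: any s+1 consecutive conjugates of z under c
   form a basis of P / L, and a dart x c^i tau^e gets as t-th coordinate the
   class of x^(c^(i+t)) modulo the span of the first s of them.  The graph
   C_{pr} is the case |rho| = 2, where P has order p. *)
Require Import Defs.
From Corelib Require Import Setoid.
From HB Require Import structures.
From mathcomp Require Import all_boot all_order all_fingroup all_solvable.
From mathcomp Require Import ssralg zmodp.
Set Implicit Arguments. Unset Strict Implicit. Unset Printing Implicit Defensive.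
Local Open Scope group_scope.

(** * Graphs of rotary maps *)

(** Uniqueness is what calls for a distributive lattice. Map isomorphisms match [rho] with [rho] and
    [tau] with [tau] up to a left translation, so quotient maps of [G] are isomorphic only if their
    kernels are equal, and a product decomposition of the map amounts to a family of kernels with
    trivial intersection. Complete reducibility alone would allow isomorphic submodules, hence many
    such families. In a distributive lattice a maximal [L] is prime: containing an intersection of
    kernels, it contains one of them. This determines the family. On the graph side, [P] is pinned
    from two sides. Walks along forward edges show that the normal closure of [z] has at least
    p^(s+1) elements, while an element acting trivially on the levels is determined by the image of
    one dart, which leaves at most p^(s+1) of them. *)

Lemma lcoset_eqE (gT : finGroupType) (H : {group gT}) (x y : gT) :
  (x *: H == y *: H) = (x^-1 * y \in H).
Proof.
rewrite -mem_lcoset; apply/eqP/idP => [->|]; first exact: lcoset_refl.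
by move/lcoset_eqP->.
Qed.

Section GraphInterface.
Variables (D : rdata) (V E : finType) (tl hd : E -> V) (inc : V -> E -> bool).
Hypothesis incE : forall v e, inc v e = (v == tl e) || (v == hd e).
Hypothesis rotD : is_rotary D.
Local Notation G := (rG D).
Local Notation rho := (rrho D).
Local Notation tau := (rtau D).

Lemma rotary_rhoG : rho \in G.
Proof. by have [-> _] := rotD; rewrite mem_gen // !inE eqxx. Qed.

Lemma rotary_tauG : tau \in G.
Proof. by have [-> _] := rotD; rewrite mem_gen // !inE eqxx orbT. Qed.

Lemma mem_cycle_tau x : (x \in <[tau]>) = (x == 1) || (x == tau).
Proof.
by have [_ t2] := rotD; rewrite (cycle2g t2) !inE.
Qed.

(** A group element [g] is read as a dart, at the vertex [g *: <[rho]>] on the edge [g *: <[tau]>];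
    the other dart of this edge is [g * tau]. Surjectivity onto [V] and [E] comes from the two index
    hypotheses by counting. *)
Lemma rota_graph_isoI (Fv : rgT D -> V) (Fe : rgT D -> E) :
  {in G &, forall x y, (Fv x == Fv y) = (x^-1 * y \in <[rho]>)} ->
  {in G &, forall x y, (Fe x == Fe y) = (x^-1 * y \in <[tau]>)} ->
  #|G : <[rho]>| = #|V| -> #|G : <[tau]>| = #|E| ->
  {in G, forall x, Fv x = tl (Fe x) /\ Fv (x * tau) = hd (Fe x) \/
                   Fv x = hd (Fe x) /\ Fv (x * tau) = tl (Fe x)} ->
  rota_graph_iso D inc.
Proof.
move=> FvE FeE cV cE ends.
have reprP (H : {group rgT D}) A : H \subset G -> A \in lcosets H G ->
    repr A \in G /\ A = repr A *: H.
  move=> sHG /imsetP[x Gx ->]; rewrite lcosetE; have xr : repr (x *: H) \in x *: H.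
    exact: (mem_repr x (lcoset_refl _ _)).
  have Gr : repr (x *: H) \in G.
    by case/lcosetP: xr => u Hu ->; rewrite groupM // (subsetP sHG).
  by split=> //; apply/lcoset_eqP; rewrite lcoset_sym.
have sR : <[rho]> \subset G by rewrite cycle_subG rotary_rhoG.
have sT : <[tau]> \subset G by rewrite cycle_subG rotary_tauG.
have injF (W : eqType) (H : {group rgT D}) (F : rgT D -> W) : H \subset G ->
    {in G &, forall x y, (F x == F y) = (x^-1 * y \in H)} ->
    {in lcosets H G &, injective (fun A => F (repr A))}.
  move=> sH FE A B lA lB; have [GA eA] := reprP H A sH lA; have [GB eB] := reprP H B sH lB.
  by move/eqP; rewrite FE // -lcoset_eqE -eA -eB => /eqP.
have fullF (W : finType) (H : {group rgT D}) (F : rgT D -> W) : H \subset G ->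
    {in G &, forall x y, (F x == F y) = (x^-1 * y \in H)} -> #|G : H| = #|W| ->
    [set F (repr A) | A in lcosets H G] = setT.
  move=> sH FE cW; apply/eqP; rewrite eqEcard subsetT /= cardsT.
  by rewrite (card_in_imset (injF _ _ _ sH FE)) card_lcosets cW.
exists (fun A => Fv (repr A)), (fun A => Fe (repr A)); split.
- exact: injF.
- exact: fullF.
- exact: injF.
- exact: fullF.
move=> A lA B lB; have [Gx eA] := reprP _ _ sR lA; have [Gy eB] := reprP _ _ sT lB.
set x := repr A in Gx eA *; set y := repr B in Gy eB *.
have Gyt : y * tau \in G by rewrite groupM ?rotary_tauG.
have -> : inc (Fv x) (Fe y) = (Fv x == Fv y) || (Fv x == Fv (y * tau)).
  by rewrite incE; case: (ends y Gy) => [] [<- <-]; rewrite // orbC.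
rewrite !FvE // eA eB; apply/idP/set0Pn.
  case/orP=> xy; [exists y | exists (y * tau)].
    by rewrite inE !mem_lcoset xy mulVg group1.
  by rewrite inE !mem_lcoset xy mulKg cycle_id.
case=> u; rewrite inE !mem_lcoset mem_cycle_tau => /andP[xu] /orP[]/eqP yu.
  by rewrite -(mulg1 y) -yu mulKVg xu.
by rewrite -yu mulKVg xu orbT.
Qed.

Lemma rota_graph_isoE : rota_graph_iso D inc -> (1 < #|V|)%N ->
  exists (Fv : rgT D -> V) (Fe : rgT D -> E),
  [/\ {in G &, forall x y, (Fv x == Fv y) = (x^-1 * y \in <[rho]>)},
      {in G &, forall x y, (Fe x == Fe y) = (x^-1 * y \in <[tau]>)},
      (forall v, exists2 x, x \in G & Fv x = v),
      (forall e, exists2 x, x \in G & Fe x = e) &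
      {in G, forall x, Fv x = tl (Fe x) /\ Fv (x * tau) = hd (Fe x) \/
                       Fv x = hd (Fe x) /\ Fv (x * tau) = tl (Fe x)}] /\
  [/\ #|G| = (#|V| * #[rho])%N, #|G| = (#|E| * 2)%N & tau \notin <[rho]>].
Proof.
case=> fv [fe [vinj vim einj eim vinc]] V_gt1.
have lG (H : {group rgT D}) x : x \in G -> x *: H \in lcosets H G.
  by move=> Gx; apply/imsetP; exists x => //; rewrite lcosetE.
have FvE : {in G &, forall x y, (fv (x *: <[rho]>) == fv (y *: <[rho]>)) = (x^-1 * y \in <[rho]>)}.
  by move=> x y Gx Gy; rewrite (inj_in_eq vinj) ?lcoset_eqE ?lG.
have FeE : {in G &, forall x y, (fe (x *: <[tau]>) == fe (y *: <[tau]>)) = (x^-1 * y \in <[tau]>)}.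
  by move=> x y Gx Gy; rewrite (inj_in_eq einj) ?lcoset_eqE ?lG.
have sR : <[rho]> \subset G by rewrite cycle_subG rotary_rhoG.
have sT : <[tau]> \subset G by rewrite cycle_subG rotary_tauG.
have cV : #|G : <[rho]>| = #|V| by rewrite -cardsT -vim card_in_imset ?card_lcosets.
have cE : #|G : <[tau]>| = #|E| by rewrite -cardsT -eim card_in_imset ?card_lcosets.
(* Otherwise [<[rho]>] is all of [G] and there is a single vertex. Hence the two ends of an edge are
   distinct, and its two incidences single out its tail and its head. *)
have tR : tau \notin <[rho]>.
  apply/negP=> tr; move: V_gt1; rewrite -cV.
  have -> : <[rho]> = G.
    apply/eqP; rewrite eqEsubset sR; have [-> _] := rotD.
    by rewrite gen_subG subUset !sub1set cycle_id.
  by rewrite indexgg.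
exists (fun x => fv (x *: <[rho]>)), (fun x => fe (x *: <[tau]>)).
split; split=> //.
- move=> v; have : v \in [set: V] by [].
  by rewrite -vim => /imsetP[_ /imsetP[x Gx ->] ->]; exists x; rewrite ?lcosetE.
- move=> e; have : e \in [set: E] by [].
  by rewrite -eim => /imsetP[_ /imsetP[x Gx ->] ->]; exists x; rewrite ?lcosetE.
- move=> x Gx; have Gxt : x * tau \in G by rewrite groupM ?rotary_tauG.
  have i1 : inc (fv (x *: <[rho]>)) (fe (x *: <[tau]>)).
    by rewrite vinc ?lG //; apply/set0Pn; exists x; rewrite inE !lcoset_refl.
  have i2 : inc (fv ((x * tau) *: <[rho]>)) (fe (x *: <[tau]>)).
    rewrite vinc ?lG //; apply/set0Pn; exists (x * tau).
    by rewrite inE lcoset_refl mem_lcoset mulKg cycle_id.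
  have ne : fv (x *: <[rho]>) != fv ((x * tau) *: <[rho]>).
    by rewrite FvE // mulKg.
  move: i1 i2 ne; rewrite !incE.
  by case/orP=> /eqP-> /orP[]/eqP->; rewrite ?eqxx //; [left | right].
- by rewrite -cV mulnC Lagrange.
- by have [_ t2] := rotD; rewrite -cE -t2 mulnC Lagrange.
Qed.
End GraphInterface.

Lemma rota_graph_iso_trans (D : rdata) (V E V' E' : finType)
    (inc : V -> E -> bool) (inc' : V' -> E' -> bool) (a : V -> V') (b : E -> E') :
  bijective a -> bijective b -> (forall v e, inc' (a v) (b e) = inc v e) ->
  rota_graph_iso D inc -> rota_graph_iso D inc'.
Proof.
move=> ba bb ab [fv [fe [vinj vim einj eim vinc]]].
have ia := bij_inj ba; have ib := bij_inj bb.
exists (a \o fv), (b \o fe); split.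
- by move=> x y Gx Gy /ia; apply: vinj.
- rewrite imset_comp vim; apply/setP=> v; rewrite inE.
  by case: ba => a' _ a'K; rewrite -(a'K v) imset_f.
- by move=> x y Gx Gy /ib; apply: einj.
- rewrite imset_comp eim; apply/setP=> v; rewrite inE.
  by case: bb => b' _ b'K; rewrite -(b'K v) imset_f.
by move=> A GA B GB; rewrite /= ab vinc.
Qed.

Definition ptail p r s (e : PXE p r s) : PXV p r s :=
  (e.1, [ffun j : 'I_s => e.2 (widen_ord (leqnSn s) j)]).
Definition phead p r s (e : PXE p r s) : PXV p r s :=
  (ordS e.1, [ffun j : 'I_s => e.2 (lift ord0 j)]).

Lemma PXincE p r s (v : PXV p r s) (e : PXE p r s) :
  PXinc v e = (v == ptail e) || (v == phead e).
Proof.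
case: v => i x; rewrite /PXinc /ptail /phead !xpair_eqE /=.
have eqF (f : 'I_s -> 'I_p) : [forall j, x j == f j] = (x == [ffun j => f j]).
  apply/forallP/eqP => [xf|-> j]; last by rewrite ffunE.
  by apply/ffunP=> j; rewrite ffunE; apply/eqP.
by rewrite !eqF.
Qed.

(** For [s = 0] the vertex tuples are empty and an edge keeps one coordinate, which numbers the [p]
    parallel edges. Below, the multiple cycle is thus a PX graph like the others. *)
Lemma MC_PX0 p r (D : rdata) :
  rota_graph_iso D (@MCinc p r) <-> rota_graph_iso D (@PXinc p r 0).
Proof.
pose f0 : {ffun 'I_0 -> 'I_p} := [ffun i : 'I_0 => match notF (ltn_ord i) with end].
have f0E (f : {ffun 'I_0 -> 'I_p}) : f = f0 by apply/ffunP=> -[].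
pose a (v : 'I_r) : PXV p r 0 := (v, f0).
pose b (e : 'I_r * 'I_p) : PXE p r 0 := (e.1, [ffun=> e.2]).
pose a' (v : PXV p r 0) : 'I_r := v.1.
pose b' (e : PXE p r 0) : 'I_r * 'I_p := (e.1, e.2 ord0).
have aK : cancel a a' by [].
have a'K : cancel a' a by case=> i f; rewrite /a /= (f0E f).
have bK : cancel b b' by case=> i y; rewrite /b' /b /= ffunE.
have b'K : cancel b' b.
  by case=> i f; rewrite /b' /b /=; congr (_, _); apply/ffunP=> j; rewrite ffunE (ord1 j).
have ab v e : PXinc (a v) (b e) = MCinc v e.
  by rewrite /PXinc /MCinc /=; congr (_ || _); apply/andb_idr => _; apply/forallP=> -[].
split.
  by apply: (rota_graph_iso_trans (a := a) (b := b)) => //; [exists a'|exists b'].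
apply: (rota_graph_iso_trans (a := a') (b := b')) => [||v e]; [by exists a|by exists b|].
by rewrite -ab a'K b'K.
Qed.

(** * Groups with a normal elementary abelian subgroup of index 2r *)

(** In a finite group, products of generators suffice, without inverses; so the two dart operations
    give an induction principle. *)
Lemma gen2_ind (gT : finGroupType) (G : {group gT}) (x y : gT)
    (Q : gT -> Prop) :
  G :=: <<[set x; y]>> -> Q 1 ->
  (forall g, g \in G -> Q g -> Q (g * x)) ->
  (forall g, g \in G -> Q g -> Q (g * y)) ->
  forall g, g \in G -> Q g.
Proof.
move=> defG Q1 Qx Qy g; rewrite defG => /gen_prodgP[n [c cS ->]].
suff: Q (\prod_i c i) /\ \prod_i c i \in G by case.
elim: n c cS => [|n IHn] c cS; first by rewrite big_ord0.
rewrite big_ord_recr /=.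
have [//|Qp Gp] := IHn (fun i => c (widen_ord (leqnSn n) i)).
have: c ord_max \in [set x; y] by [].
by case/set2P=> ->; (split; [by auto | rewrite groupM // defG mem_gen //]);
   rewrite !inE eqxx ?orbT.
Qed.

(** Gaschutz's theorem replaces averaging: [U] has a complement in [P], hence a complement [M] in
    [G]. Then [W = M :&: P] is normalised by [M] and centralised by [U], so it is normal in
    [U * M = G]. *)
Lemma Maschke_abelem (gT : finGroupType) (p : nat) (G P U : {group gT}) :
  p.-abelem P -> P <| G -> coprime #|P| #|G : P| -> U <| G -> U \subset P ->
  exists W : {group gT}, [/\ W <| G, U * W = P & U :&: W = 1].
Proof.
move=> abP nPG coP nUG sUP.
have cPP := abelem_abelian abP.
have coU: coprime #|U| #|G : P| by apply: coprime_dvdl coP; apply: cardSg.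
have spl: [splits P, over U].
  apply/splitsP; have [C /dprodP[_ UC _ tiUC]] := abelem_split_dprod abP sUP.
  by exists C; apply/complP.
have := Gaschutz_split nUG sUP (normal_sub nPG) (abelianS sUP cPP) coU.
rewrite spl => /splitsP[M /complP[tiUM UM]].
have sMG: M \subset G by rewrite -UM mulG_subr.
exists (M :&: P)%G; split => /=.
- have nMP: M \subset 'N(M :&: P).
    by rewrite normsI ?normG // (subset_trans sMG (normal_norm nPG)).
  rewrite /normal subIset ?sMG //= -UM mulG_subG nMP andbT cents_norm //.
  by rewrite (sub_abelian_cent2 cPP) // subsetIr.
- by rewrite group_modl // UM; apply/setIidPr; apply: normal_sub.
by rewrite setIA tiUM; apply/setIidPl; rewrite sub1G.
Qed.

(** The order of [rho] is left open, so that this covers both the PX graphs, with [rho] of order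
    [2 * p], and the cycle, with [rho] of order 2. *)
Record core (p r : nat) (gT : finGroupType) (G P : {group gT})
    (rho tau : gT) : Prop := Core {
  core_gen : G :=: <<[set rho; tau]>>;
  core_tau : #[tau] = 2;
  core_normal : P <| G;
  core_abelem : p.-abelem P;
  core_card : #|G| = (2 * r * #|P|)%N;
  core_rho2 : rho ^+ 2 \in P }.

Section CoreTheory.
Variables (p r : nat).
Hypotheses (pr_p : prime p) (odd_p : odd p) (r_ge3 : 3 <= r) (p_r : ~~ (p %| r)).

Lemma coprime_p_2r : coprime p (2 * r)%N.
Proof. by rewrite coprimeMr coprimen2 odd_p prime_coprime. Qed.

Section OneGroup.
Variables (gT : finGroupType) (G P : {group gT}) (rho tau : gT).
Hypothesis cG : core p r G P rho tau.

Lemma core_rhoG : rho \in G.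
Proof. by rewrite (core_gen cG) mem_gen // !inE eqxx. Qed.

Lemma core_tauG : tau \in G.
Proof. by rewrite (core_gen cG) mem_gen // !inE eqxx orbT. Qed.

Lemma core_pP : p.-group P.
Proof. exact: abelem_pgroup (core_abelem cG). Qed.

Lemma core_index : #|G : P| = (2 * r)%N.
Proof.
by rewrite -divgS ?(normal_sub (core_normal cG)) // (core_card cG) mulnK.
Qed.

Lemma core_coprime : coprime #|P| #|G : P|.
Proof.
rewrite core_index; have [n ->] := p_natP core_pP.
by rewrite coprimeXl // coprime_p_2r.
Qed.

Lemma core_Hall : p.-Sylow(G) P.
Proof.
rewrite pHallE (normal_sub (core_normal cG)) (core_card cG) /=.
rewrite partnM ?muln_gt0 ?(leq_trans _ r_ge3) //.
have p'2r: p^'.-nat (2 * r)%N by rewrite p'natE // -prime_coprime // coprime_p_2r.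
by rewrite part_p'nat // mul1n (part_pnat_id core_pP).
Qed.

Lemma core_pgroup_sub (A : {group gT}) : A \subset G -> p.-group A -> A \subset P.
Proof. by move=> sAG pA; rewrite (sub_normal_Hall core_Hall (core_normal cG)). Qed.

(** The images of [rho] and [tau] generate [G / P] and have trivial squares. If one were trivial, or
    both equal, [G / P] would have order at most 2; so they are distinct involutions. *)
Lemma core_dihedral (K : {group gT}) : P ><| K = G -> K \isog 'D_(2 * r).
Proof.
move=> defG; have nPG := core_normal cG.
have nP x : x \in G -> x \in 'N(P) by move/(subsetP (normal_norm nPG)).
have nr := nP _ core_rhoG; have nt := nP _ core_tauG.
have isoK := sdprod_isog defG; apply: isog_trans isoK _.
have defQ: G / P = <<[set coset P rho; coset P tau]>>.
  rewrite {1}(core_gen cG) quotient_gen; last first.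
    by apply/subsetP=> x /set2P[]->.
  by rewrite quotientU !quotient_set1.
have cardQ: #|G / P| = (2 * r)%N by rewrite card_quotient ?normal_norm ?core_index.
have r2: coset P rho ^+ 2 = 1 by rewrite -morphX //= coset_id // (core_rho2 cG).
have t2: coset P tau ^+ 2 = 1.
  by rewrite -morphX //; have := core_tau cG => <-; rewrite expg_order morph1.
have small (x : coset_of P) : x ^+ 2 = 1 -> G / P = <[x]> -> False.
  move=> x2 defx; move: (order_dvdn x 2); rewrite x2 eqxx /order -defx cardQ.
  move/idP/(dvdn_leq (isT : 0 < 2)%N); rewrite leqNgt => /negP[].
  by rewrite -{1}[2%N]muln1 ltn_pmul2l // (leq_trans _ r_ge3).
have o2 (x : coset_of P) : x ^+ 2 = 1 -> x != 1 -> #[x] = 2.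
  by move=> x2 nx; apply: nt_prime_order.
have cyc (x : coset_of P) : <<[set 1; x]>> = <[x]>.
  apply/eqP; rewrite eqEsubset gen_subG subUset !sub1set group1 cycle_id.
  by rewrite cycle_subG mem_gen // !inE eqxx orbT.
have rn1: coset P rho != 1.
  by apply/eqP=> r1; apply: (small _ t2); rewrite defQ r1 cyc.
have tn1: coset P tau != 1.
  by apply/eqP=> t1; apply: (small _ r2); rewrite defQ t1 setUC cyc.
have nrt: coset P rho != coset P tau.
  apply/eqP=> rt; apply: (small _ r2); rewrite defQ -rt /cycle setUid //.
by have := involutions_gen_dihedral (o2 _ r2 rn1) (o2 _ t2 tn1) nrt; rewrite -defQ cardQ.
Qed.

Lemma core_split : exists K : {group gT}, P ><| K = G /\ K \isog 'D_(2 * r).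
Proof.
have hP: Hall G P by rewrite /Hall (normal_sub (core_normal cG)) core_coprime.
have /splitsP[K /complP[ti PK]] := SchurZassenhaus_split hP (core_normal cG).
have defG: P ><| K = G.
  rewrite sdprodE //; apply: subset_trans (normal_norm (core_normal cG)).
  by rewrite -PK mulG_subr.
by exists K; split=> //; apply: core_dihedral.
Qed.

Lemma core_quotient (L : {group gT}) : L <| G -> L \subset P ->
  core p r (G / L) (P / L) (coset L rho) (coset L tau).
Proof.
move=> nLG sLP; have sPG := normal_sub (core_normal cG).
have nL x : x \in G -> x \in 'N(L) by move/(subsetP (normal_norm nLG)).
have nr := nL _ core_rhoG; have nt := nL _ core_tauG.
have nLP: P \subset 'N(L) by apply: subset_trans (normal_norm nLG).
split.
- rewrite /= (core_gen cG) quotient_gen; last by apply/subsetP=> x /set2P[]->.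
  by rewrite quotientU !quotient_set1.
- apply: nt_prime_order => //.
    by rewrite -morphX //; have := core_tau cG => <-; rewrite expg_order morph1.
  apply/eqP => /(coset_idr nt) tL.
  have := mem_p_elt (pgroupS sLP core_pP) tL.
  by rewrite /p_elt (core_tau cG) pnatE // inE /= => /eqP p2; move: odd_p; rewrite -p2.
- exact: quotient_normal (core_normal cG).
- exact: quotient_abelem (core_abelem cG).
- rewrite /= !card_quotient ?(normal_norm nLG) //.
  rewrite -(divgS sLP) -(divgS (normal_sub nLG)).
  by rewrite (core_card cG) muln_divA ?cardSg.
- by rewrite -morphX // mem_quotient // (core_rho2 cG).
Qed.

End OneGroup.
End CoreTheory.

(** * Maximal invariant subgroups as primes of a distributive lattice *)

Definition max_normal_in (gT : finGroupType) (G P : {group gT}) : pred {group gT} :=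
  fun L => maxgroup L (fun H : {group gT} => (H <| G) && (H \proper P)).

(** The instance of the law [L * (A :&: B) = (L * A) :&: (L * B)] that makes maximal elements prime:
    the left side is [L], the right side [P]. *)
Definition distributive_in (gT : finGroupType) (G P : {group gT}) : Prop :=
  forall A B L : {group gT},
    A <| G -> B <| G -> L <| G -> A \subset P -> B \subset P -> L \subset P ->
    A :&: B \subset L -> L * A = P -> L * B = P -> L :=: P.

Section MaxNormal.
Variables (gT : finGroupType) (G P : {group gT}).
Hypotheses (nPG : P <| G) (distP : distributive_in G P).
Implicit Types (A B L M : {group gT}) (s : seq {group gT}).

Lemma max_normalP L : max_normal_in G P L ->
  [/\ L <| G, L \proper P &
      forall H : {group gT}, H <| G -> H \proper P -> L \subset H -> H :=: L].
Proof.
case/maxgroupP=> /andP[nL pL] mL; split=> // H nH pH sLH.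
by rewrite (mL H) // nH pH.
Qed.

Lemma max_normal_mul L A : max_normal_in G P L -> A <| G -> A \subset P ->
  ~~ (A \subset L) -> L * A = P.
Proof.
case/max_normalP=> nL pL mL nA sAP nAL.
have sLP := proper_sub pL.
have eLA: L <*> A = L * A.
  apply: norm_joinEr; apply: subset_trans (normal_norm nL); exact: normal_sub.
have nLA: (L <*> A)%G <| G by rewrite normalY.
rewrite -eLA; apply/eqP; case: eqVneq => // neP.
have pLA: (L <*> A)%G \proper P.
  by rewrite properEneq neP /= join_subG sLP sAP.
have := mL _ nLA pLA (joing_subl _ _) => /= eL.
by case/negP: nAL; rewrite -eL joing_subr.
Qed.

Lemma max_normal_prime L A B : max_normal_in G P L ->
  A <| G -> B <| G -> A \subset P -> B \subset P -> A :&: B \subset L ->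
  A \subset L \/ B \subset L.
Proof.
move=> mL nA nB sA sB sAB.
case: (boolP (A \subset L)) => [|nAL]; first by left.
case: (boolP (B \subset L)) => [|nBL]; first by right.
have [nL pL _] := max_normalP mL.
have := distP nA nB nL sA sB (proper_sub pL) sAB (max_normal_mul mL nA sA nAL)
  (max_normal_mul mL nB sB nBL).
by move=> eLP; move: pL; rewrite eLP properxx.
Qed.

Definition capg s : {group gT} := foldr (fun L M => (L :&: M)%G) P s.

Lemma mem_capg s x : (x \in capg s) = (x \in P) && all (fun L : {group gT} => x \in L) s.
Proof. by elim: s => [|L s IHs] /=; rewrite ?andbT // inE IHs andbCA. Qed.

Lemma capg_sub s : capg s \subset P.
Proof. by apply/subsetP=> x; rewrite mem_capg => /andP[]. Qed.

Lemma capg_normal s : {in s, forall M, M <| G} -> capg s <| G.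
Proof.
elim: s => [|M s IHs] nS //=; apply: normalI; first exact/nS/mem_head.
by apply: IHs => N Ns; apply: nS; rewrite inE Ns orbT.
Qed.

Lemma max_normal_capg L s : max_normal_in G P L ->
  {in s, forall M, M <| G} -> {in s, forall M, M \subset P} ->
  capg s \subset L -> exists2 M, M \in s & M \subset L.
Proof.
move=> mL; elim: s => [|M s IHs] nS sS /=.
  move=> sPL; have [_ pL _] := max_normalP mL.
  by move: (proper_subn pL); rewrite sPL.
have nS': {in s, forall M, M <| G} by move=> N Ns; apply: nS; rewrite inE Ns orbT.
have sS': {in s, forall M, M \subset P} by move=> N Ns; apply: sS; rewrite inE Ns orbT.
have nM := nS M (mem_head _ _); have sM := sS M (mem_head _ _).
case/(max_normal_prime mL nM (capg_normal nS') sM (capg_sub s)) => [sML|].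
  by exists M => //; apply: mem_head.
by case/(IHs nS' sS') => N Ns sN; exists N; rewrite // inE Ns orbT.
Qed.

(** By primeness [L] cannot contain the intersection of the others: it would contain one of them
    and, by maximality, equal it, against [uniq]. So [L] and this intersection have product [P], and
    the indices multiply. *)
Lemma index_capg s : uniq s -> all (max_normal_in G P) s ->
  #|P : capg s| = (\prod_(M <- s) #|P : M|)%N.
Proof.
elim: s => [|L s IHs] /=; first by rewrite big_nil indexgg.
case/andP=> Ls us /andP[mL ms]; rewrite big_cons -IHs //.
have mS M : M \in s -> max_normal_in G P M by apply/allP.
have nI: capg s <| G by apply: capg_normal => M /mS/max_normalP[].
have [nL pL _] := max_normalP mL.
have LI: L * capg s = P.
  apply: (max_normal_mul mL nI (capg_sub s)); apply/negP => sIL.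
  have [|||M Ms sML] := max_normal_capg (s := s) mL.
  - by move=> M /mS/max_normalP[].
  - by move=> M /mS/max_normalP[_ /proper_sub].
  - exact: sIL.
  have [_ _ mM] := max_normalP (mS M Ms).
  have eLM: L :=: M by apply: mM.
  by case/negP: Ls; rewrite (group_inj eLM).
have sLIP: L :&: capg s \subset P by rewrite subIset // (proper_sub pL).
have := mul_cardG L (capg s); rewrite LI => cLI.
have eL := Lagrange (proper_sub pL); have eI := Lagrange (capg_sub s).
have eLI := Lagrange sLIP; rewrite /= in eLI.
apply/eqP; rewrite -(eqn_pmul2l (cardG_gt0 (L :&: capg s))) eLI.
by rewrite -(eqn_pmul2l (cardG_gt0 P)) mulnA -cLI mulnACA eL eI.
Qed.
End MaxNormal.

(** * Map isomorphisms between quotients of one group *)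

Lemma cmap_iso_span (M N : cmap) (A : finType) (G : {set A}) (R T : A -> A)
    (f : A -> dart M) (g : A -> dart N) :
  {in G, forall x, R x \in G} -> {in G, forall x, T x \in G} ->
  f @: G = darts M -> g @: G = darts N ->
  {in G, forall x, f (R x) = crot M (f x)} ->
  {in G, forall x, f (T x) = cedge M (f x)} ->
  {in G, forall x, g (R x) = crot N (g x)} ->
  {in G, forall x, g (T x) = cedge N (g x)} ->
  {in G &, forall x y, (f x == f y) = (g x == g y)} ->
  (exists x, x \in G) ->
  cmap_iso M N.
Proof.
move=> RG TG fG gG fR fT gR gT fg [x0 Gx0].
(* Since [f] and [g] have the same fibres, the preimage picked does not matter; [x0] is only the
   value outside the image of [f]. *)
pose h u := g (odflt x0 [pick x in G | f x == u]).
have hf x : x \in G -> h (f x) = g x.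
  move=> Gx; rewrite /h; case: pickP => [y /andP[Gy /eqP fy]|/(_ x)] /=.
    by apply/eqP; rewrite -fg // fy.
  by rewrite Gx eqxx.
exists h; split.
- move=> u v; rewrite -fG => /imsetP[x Gx ->] /imsetP[y Gy ->].
  by rewrite !hf // => /eqP; rewrite -fg // => /eqP.
- rewrite -fG -gG; apply/setP=> w; apply/imsetP/imsetP.
    by case=> u /imsetP[x Gx ->] ->; exists x; rewrite ?hf.
  by case=> x Gx ->; exists (f x); rewrite ?hf ?imset_f.
- by move=> u; rewrite -fG => /imsetP[x Gx ->]; rewrite -fR // !hf ?RG // gR.
- by move=> u; rewrite -fG => /imsetP[x Gx ->]; rewrite -fT // !hf ?TG // gT.
Qed.

(** A map isomorphism need not fix 1, since left translations are automorphisms; dividing by [f 1]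
    on the left removes the translation. *)
Lemma equivariant_morph (gT hT : finGroupType) (G : {group gT})
    (rho tau : gT) (rho' tau' : hT) (f : gT -> hT) :
  G :=: <<[set rho; tau]>> ->
  {in G, forall x, f (x * rho) = f x * rho'} ->
  {in G, forall x, f (x * tau) = f x * tau'} ->
  {in G &, {morph (fun x => (f 1)^-1 * f x) : x y / x * y}}.
Proof.
move=> defG fr ft x y Gx; move: y; apply: (gen2_ind defG) => [|y Gy IH|y Gy IH].
- by rewrite mulg1 mulVg mulg1.
- by rewrite (mulgA x) !fr ?groupM // !mulgA IH !mulgA.
- by rewrite (mulgA x) !ft ?groupM // !mulgA IH !mulgA.
Qed.

Definition qdata (gT : finGroupType) (G : {group gT}) (rho tau : gT) (L : {group gT}) :=
  @RData _ (G / L)%G (coset L rho) (coset L tau).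

Section Quotients.
Variables (gT : finGroupType) (G : {group gT}) (rho tau : gT).
Hypothesis defG : G :=: <<[set rho; tau]>>.

Let Grho : rho \in G. Proof. by rewrite defG mem_gen // !inE eqxx. Qed.
Let Gtau : tau \in G. Proof. by rewrite defG mem_gen // !inE eqxx orbT. Qed.

(** Once normalised at 1, an isomorphism sends [coset L x] to [coset M x], by induction on words in
    [rho] and [tau]. Being well defined and injective, it forces [L] and [M] to agree. *)
Lemma qdata_inj (L M : {group gT}) : L <| G -> M <| G ->
  cmap_iso (rota_cmap (qdata G rho tau L)) (rota_cmap (qdata G rho tau M)) ->
  L :=: M.
Proof.
move=> nL nM [f [/= f_inj _ fr ft]].
have nLx x : x \in G -> x \in 'N(L) by move/(subsetP (normal_norm nL)).
have nMx x : x \in G -> x \in 'N(M) by move/(subsetP (normal_norm nM)).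
have GL x : x \in G -> coset L x \in (G / L)%G by move=> Gx; rewrite mem_quotient.
have Ff x : x \in G -> (f 1)^-1 * f (coset L x) = coset M x.
  move: x; apply: (gen2_ind defG) => [|x Gx IH|x Gx IH].
  - by rewrite !morph1 mulVg.
  - by rewrite !morphM ?nLx ?nMx //= fr ?GL // mulgA IH.
  - by rewrite !morphM ?nLx ?nMx //= ft ?GL // mulgA IH.
have eLM x : x \in G -> (x \in L) = (x \in M).
  move=> Gx; apply/idP/idP => xL.
    by apply: coset_idr; rewrite ?nMx // -Ff // coset_id // mulVg.
  apply: coset_idr; rewrite ?nLx //; apply: f_inj; rewrite ?GL ?group1 //.
  by apply: (mulgI (f 1)^-1); rewrite Ff // mulVg coset_id.
apply/setP=> x; case Gx: (x \in G); first exact: eLM.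
apply/idP/idP=> [/(subsetP (normal_sub nL))|/(subsetP (normal_sub nM))].
  by rewrite Gx.
by rewrite Gx.
Qed.

Lemma coset_eq_mem (L : {group gT}) x y : L <| G -> x \in G -> y \in G ->
  (coset L x == coset L y) = (x^-1 * y \in L).
Proof.
move=> nL Gx Gy; have nLx := subsetP (normal_norm nL).
apply/eqP/idP => [exy|xyL].
  apply: coset_idr; rewrite ?nLx ?groupM ?groupV //.
  by rewrite morphM ?morphV ?groupV ?nLx //= exy mulVg.
apply/eqP; rewrite eq_mulVg1 -morphV ?nLx //= -morphM ?groupV ?nLx //=.
by rewrite coset_id.
Qed.

(** The diagonal map into the product is injective by the trivial intersection. Its image is exactly
    [pH], because each step from [f x] leads to [f (x * rho)] or [f (x * tau)]. *)
Lemma qdata_prod_iso (k : nat) (L : 'I_k -> {group gT}) :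
  (forall i, L i <| G) -> (forall x, x \in G -> (forall i, x \in L i) -> x = 1) ->
  cmap_iso (rota_cmap (RData G rho tau)) (prod_cmap (fun i => qdata G rho tau (L i))).
Proof.
move=> nL tiL; set Ms := fun i => _.
have nLx i x : x \in G -> x \in 'N(L i) by move/(subsetP (normal_norm (nL i))).
pose f (x : gT) : ptype Ms := [ffun i => coset (L i) x].
have fr : {in G, forall x, f (x * rho) = pmul (f x) (prho Ms)}.
  by move=> x Gx; apply/ffunP=> i; rewrite !ffunE morphM ?nLx.
have ft : {in G, forall x, f (x * tau) = pmul (f x) (ptau Ms)}.
  by move=> x Gx; apply/ffunP=> i; rewrite !ffunE morphM ?nLx.
have f1 : f 1 = pone Ms by apply/ffunP=> i; rewrite !ffunE morph1.
exists f; split => //=.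
- move=> x y Gx Gy /ffunP efxy; apply/eqP; rewrite eq_mulVg1; apply/eqP.
  apply: tiL => [|i]; first by rewrite groupM ?groupV.
  by rewrite -coset_eq_mem //; have := efxy i; rewrite !ffunE => ->.
apply/setP=> y; rewrite inE; apply/imsetP/idP => [[x Gx ->]|].
  move: x Gx; apply: (gen2_ind defG) => [|x Gx IH|x Gx IH].
  - by rewrite f1 connect0.
  - by apply: (connect_trans IH); apply: connect1; rewrite fr // /pstep eqxx.
  - by apply: (connect_trans IH); apply: connect1; rewrite ft // /pstep eqxx orbT.
case/connectP=> s; rewrite -f1; move: (group1 G); move: 1.
elim: s => [|u s IHs] x Gx /=; first by move=> _ ->; exists x.
case/andP=> /orP[]/eqP->.
  by rewrite -fr //; apply: IHs; rewrite groupM.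
by rewrite -ft //; apply: IHs; rewrite groupM.
Qed.
End Quotients.

(** * Decomposition and uniqueness *)

Section Decomposition.
Variables (p r : nat).
Hypotheses (pr_p : prime p) (odd_p : odd p) (r_ge3 : 3 <= r) (p_r : ~~ (p %| r)).
Variables (gT : finGroupType) (G P : {group gT}) (rho tau : gT).
Hypothesis cG : core p r G P rho tau.
Let nPG := core_normal cG.
Let defG := core_gen cG.

(** As [P / L] is abelian, its [K]-invariant subgroups are normal in [G / L]; their preimages lie
    between [L] and [P], where maximality applies. *)
Lemma qdata_irred (L : {group gT}) : max_normal_in G P L ->
  irred_d p r (logn p #|P : L|) (qdata G rho tau L).
Proof.
move=> mL; have [nL pL maxL] := max_normalP mL.
have cQ := core_quotient odd_p cG nL (proper_sub pL).
have nLP: P \subset 'N(L) by apply: subset_trans (normal_norm nL); apply: normal_sub.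
have [K [defQ isoK]] := core_split pr_p odd_p r_ge3 p_r cQ.
exists (P / L)%G, K; split=> //.
- exact: quotient_abelem (core_abelem cG).
- rewrite -card_quotient //.
  have /p_natP[n] := quotient_pgroup L (core_pP cG).
  by rewrite /= => ->; rewrite pfactorK.
have [/= _ defPK nK _] := sdprodP defQ.
have cPP: abelian (P / L) by apply: quotient_abelian; apply: abelem_abelian (core_abelem cG).
apply/mingroupP; split.
  apply/andP; split; last by rewrite astabsJ.
  by rewrite /= -subG1 quotient_sub1 // (proper_subn pL).
move=> H /andP[ntH]; rewrite /= astabsJ => nHK sHP.
have nHQ: H <| G / L.
  rewrite /normal -defPK mulG_subG nHK andbT (subset_trans sHP) ?mulG_subl //=.
  by rewrite cents_norm // (sub_abelian_cent2 cPP).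
have sLpre: L \subset coset L @*^-1 H by apply: sub_cosetpre.
have spreP: coset L @*^-1 H \subset P.
  by rewrite sub_cosetpre_quo //; apply: (normalS _ (normal_sub nPG) nL); apply: proper_sub.
have npre: (coset L @*^-1 H)%G <| G.
  rewrite -(quotientGK nL) /= cosetpre_normal //.
apply/eqP; rewrite /= eqEsubset sHP /=.
case: (boolP ((coset L @*^-1 H)%G \proper P)) => [pp|npp].
  have /= := maxL _ npre pp sLpre => eL.
  case/negP: ntH; rewrite /= -(cosetpreK H) /= eL.
  by rewrite trivg_quotient.
have: coset L @*^-1 H = P.
  by apply/eqP; move: npp; rewrite properEneq spreP andbT negbK.
by move=> <-; rewrite cosetpreK.
Qed.

(** By orders, [N] is the normal Sylow [p]-subgroup of the image, so it is [f @* P]; as both have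
    index [2 * r], the kernel is a [p]-group and lies in [P]. An invariant proper subgroup of [P]
    above the kernel has image 1, by irreducibility of [N]. *)
Lemma irred_kernel (D : rdata) d (f : {morphism G >-> rgT D}) :
  f @* G = rG D -> irred_d p r d D -> max_normal_in G P ('ker f)%G.
Proof.
move=> fG [N [K [defD abN cardN isoK irrK]]].
have [_ NK nNK tiNK] := sdprodP defD.
have cardK: #|K| = (2 * r)%N.
  by rewrite (card_isog isoK) mul2n card_dihedral // (leq_trans _ r_ge3).
have cardD: #|rG D| = (p ^ d * (2 * r))%N by rewrite -(sdprod_card defD) cardN cardK.
have nND: N <| rG D.
  rewrite /normal -NK mulG_subl mulG_subG normG //.
have p'2r: (p^').-nat (2 * r)%N.
  by rewrite p'natE // -prime_coprime // coprime_p_2r.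
have r_gt0 : 0 < r by apply: leq_trans r_ge3.
have hN: p.-Sylow(rG D) N.
  rewrite /pHall (normal_sub nND) (abelem_pgroup abN) /=.
  rewrite -divgS ?(normal_sub nND) // cardD cardN mulKn // expn_gt0 prime_gt0 //.
have hfP: p.-Sylow(rG D) (f @* P).
  rewrite -fG; apply: morphim_pHall (core_Hall pr_p odd_p r_ge3 p_r cG) => //.
  exact: normal_sub.
have eN: N :=: f @* P.
  have nfP: f @* P <| rG D by rewrite -fG morphim_normal.
  apply/eqP; rewrite eqEcard (sub_normal_Hall hfP nfP (normal_sub nND)).
  by rewrite (pHall_pgroup hN) /= (card_Hall hN) (card_Hall hfP).
have skG: 'ker f \subset G by apply: subsetIl.
have cker: (#|'ker f| * #|rG D|)%N = #|G|.
  by rewrite -fG card_morphim setIid; apply: (Lagrange skG).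
have pker: p.-group ('ker f).
  have: (#|'ker f| * p ^ d)%N = #|P|.
    apply/eqP; rewrite -(@eqn_pmul2r (2 * r)%N) ?muln_gt0 ?r_gt0 //.
    by rewrite -mulnA -cardD cker (core_card cG) mulnC.
  move=> eP; have := core_pP cG; rewrite /pgroup -eP pnatM.
  by case/andP.
have skP: 'ker f \subset P by apply: (core_pgroup_sub pr_p odd_p r_ge3 p_r cG).
have [/andP[/= ntN _] minN] := mingroupP irrK.
have neq (H : {group gT}) : 'ker f \subset H -> H \subset P -> f @* H = f @* P -> H :=: P.
  move=> sH sHP efH; apply/eqP; rewrite eqEsubset sHP /=.
  have sPG := normal_sub nPG.
  rewrite -(morphimGK sH (subset_trans sHP sPG)) efH.
  by rewrite -sub_morphim_pre ?subxx.
apply/maxgroupP; split.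
  rewrite ker_normal properEneq skP andbT /=.
  apply: contraNneq ntN => ek; rewrite eN -ek morphim_ker //.
move=> H /andP[nH pH] sH.
have sHG := normal_sub nH; have sHP := proper_sub pH.
have nfH: f @* H <| rG D by rewrite -fG morphim_normal.
have sfHN: f @* H \subset N by rewrite eN morphimS.
have fH1: f @* H = 1.
  apply/eqP; case: eqVneq => // ntfH.
  have efH: f @* H = N.
    apply: (minN (f @* H)%G) => //; rewrite /= ntfH astabsJ.
    by apply: subset_trans (normal_norm nfH); rewrite -NK mulG_subr.
  have ePH: H :=: P by apply: neq; rewrite // efH.
  by move: pH; rewrite ePH properxx.
apply/eqP; rewrite eqEsubset sH andbT /=.
by rewrite ker_trivg_morphim sHG fH1 subxx.
Qed.

(** If the intersection were nontrivial, an invariant complement [W] of it would be proper, hence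
    inside some maximal [L]; but [L] contains the intersection as well, so it would be all of
    [P]. *)
Lemma capg_max_normal :
  capg P (enum (max_normal_in G P)) :=: 1.
Proof.
set I := capg _ _; apply/eqP; case: eqVneq => // ntI.
have mP M : M \in enum (max_normal_in G P) -> max_normal_in G P M by rewrite mem_enum.
have sIP: I \subset P by apply: capg_sub.
have nI: I <| G by apply: capg_normal => // M /mP/max_normalP[].
have [W [nW IW tiIW]] := Maschke_abelem (core_abelem cG) nPG
  (core_coprime pr_p odd_p p_r cG) nI sIP.
have sWP: W \subset P by rewrite -IW mulG_subr.
have pW: W \proper P.
  rewrite properEneq sWP andbT; apply: contraNneq ntI => eW.
  by rewrite -tiIW eW; apply/eqP/esym/setIidPl.
have [|L mL sWL] := @maxgroup_exists _ (fun H : {group gT} => (H <| G) && (H \proper P)) W.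
  by rewrite nW pW.
have [_ pL _] := max_normalP mL.
case/negP: (proper_subn pL); rewrite -IW mul_subG //.
apply/subsetP=> x; rewrite mem_capg => /andP[_ /allP]; apply.
by rewrite mem_enum.
Qed.

Hypothesis ntP : P :!=: 1.
Hypothesis distP : distributive_in G P.
Hypothesis augQ : forall L : {group gT}, L <| G -> L \proper P ->
  is_aug_PX p r (qdata G rho tau L).

Theorem core_decomposition :
  exists (k : nat) (Ms : 'I_k -> rdata) (ds : 'I_k -> nat),
    [/\ (forall i, [/\ is_rotary (Ms i), is_aug_PX p r (Ms i)
                     & irred_d p r (ds i) (Ms i)]),
        cmap_iso (rota_cmap (RData G rho tau)) (prod_cmap Ms),
        (forall i j : 'I_k, i != j ->
           ~ cmap_iso (rota_cmap (Ms i)) (rota_cmap (Ms j))),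
        (forall (k' : nat) (Ms' : 'I_k' -> rdata),
           (forall i, irreducible_aug_PX p r (Ms' i)) ->
           cmap_iso (rota_cmap (RData G rho tau)) (prod_cmap Ms') ->
           (forall i j : 'I_k', i != j ->
              ~ cmap_iso (rota_cmap (Ms' i)) (rota_cmap (Ms' j))) ->
           exists sigma : 'I_k -> 'I_k',
             bijective sigma /\
             forall i, cmap_iso (rota_cmap (Ms i)) (rota_cmap (Ms' (sigma i)))) &
        exists N K : {group gT},
          [/\ (N ><| K = G)%g, (p.-abelem N)%g,
              #|N| = (p ^ (\sum_(i < k) ds i))%N & (K \isog 'D_(2 * r))%g]].
Proof.
pose X := [set L : {group gT} | max_normal_in G P L].
pose L (i : 'I_#|X|) : {group gT} := enum_val i.
have mL i : max_normal_in G P (L i) by have := enum_valP i; rewrite inE.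
have nL i : L i <| G by case/max_normalP: (mL i).
have pL i : L i \proper P by case/max_normalP: (mL i).
have L_onto M : max_normal_in G P M -> exists i, L i = M.
  move=> mM; have XM : M \in X by rewrite inE.
  by exists (enum_rank_in XM M); rewrite /L enum_rankK_in.
(* This uses [ntP]. Over an empty family, lying in every [L i] would not even put [x] into [P]. *)
have ex_L: exists i, max_normal_in G P (L i).
  have [|M mM _] := @maxgroup_exists _ (fun H : {group gT} => (H <| G) && (H \proper P)) 1%G.
    by rewrite normal1 properEneq eq_sym ntP sub1G.
  by have [i eM] := L_onto M mM; exists i; rewrite eM.
exists #|X|, (fun i => qdata G rho tau (L i)), (fun i => logn p #|P : L i|).
split.
- move=> i; split; [|exact: augQ|exact: qdata_irred].
  have cQ := core_quotient odd_p cG (nL i) (proper_sub (pL i)).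
  by split; [exact: core_gen cQ | exact: core_tau cQ].
- apply: (qdata_prod_iso defG) => // x Gx Lx.
  have: x \in (1 : {set gT}).
    rewrite -capg_max_normal mem_capg; apply/andP; split.
      by have [i _] := ex_L; apply: (subsetP (proper_sub (pL i))).
    apply/allP=> M; rewrite mem_enum => /L_onto[i <-]; exact: Lx.
  by move/set1P.
- move=> i j nij /(qdata_inj defG (nL i) (nL j)) /group_inj.
  by move/enum_val_inj=> eij; rewrite eij eqxx in nij.
- move=> k' Ms' irrM' [phi [/= phi_inj _ phi_r phi_t]] neqM'.
  pose F i x : rgT (Ms' i) := phi x i.
  have Fr i : {in G, forall x, F i (x * rho) = F i x * rrho (Ms' i)}.
    by move=> x Gx; rewrite /F phi_r // !ffunE.
  have Ft i : {in G, forall x, F i (x * tau) = F i x * rtau (Ms' i)}.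
    by move=> x Gx; rewrite /F phi_t // !ffunE.
  (* The coordinates of [phi], normalised at 1, are morphisms of [G] onto the given factors, so the
     second decomposition is also described by kernels in [G]. *)
  pose m i : {morphism G >-> rgT (Ms' i)} := Morphism (equivariant_morph defG (Fr i) (Ft i)).
  have mE i x : m i x = (F i 1)^-1 * F i x by [].
  have mr i : {in G, forall x, m i (x * rho) = m i x * rrho (Ms' i)}.
    by move=> x Gx; rewrite !mE Fr // mulgA.
  have mt i : {in G, forall x, m i (x * tau) = m i x * rtau (Ms' i)}.
    by move=> x Gx; rewrite !mE Ft // mulgA.
  have Grho := core_rhoG cG; have Gtau := core_tauG cG.
  have m_im i : m i @* G = rG (Ms' i).
    have [[-> _] _ _] := irrM' i.
    transitivity (m i @* <<[set rho; tau]>>); first by rewrite -defG.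
    rewrite morphim_gen; last by rewrite subUset !sub1set Grho.
    by rewrite morphimU !morphim_set1 // -(mul1g rho) -(mul1g tau) mr ?mt // morph1 !mul1g.
  pose L' i := ('ker (m i))%G.
  have mL' i : max_normal_in G P (L' i).
    by have [_ _ [d irr_d]] := irrM' i; apply: irred_kernel irr_d.
  have m_eq i x y : x \in G -> y \in G -> (m i x == m i y) = (x^-1 * y \in L' i).
    move=> Gx Gy; rewrite eq_mulVg1 -morphV // -morphM ?groupV //.
    by apply/eqP/kerP => //; rewrite groupM ?groupV.
  have m_imset i : m i @: G = rG (Ms' i) by rewrite -morphimEdom.
  have iso_q i i' : L i = L' i' ->
      cmap_iso (rota_cmap (qdata G rho tau (L i))) (rota_cmap (Ms' i')).
    move=> eL; have nLx x : x \in G -> x \in 'N(L i) by apply/subsetP/normal_norm.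
    apply: (@cmap_iso_span (rota_cmap (qdata G rho tau (L i))) (rota_cmap (Ms' i')) gT G
             (mulg^~ rho) (mulg^~ tau) (coset (L i)) (m i')) => //=.
    - by move=> x Gx; rewrite groupM.
    - by move=> x Gx; rewrite groupM.
    - by rewrite -morphimEsub // normal_norm.
    - by move=> x Gx; rewrite morphM ?nLx.
    - by move=> x Gx; rewrite morphM ?nLx.
    - by move=> x y Gx Gy; rewrite (coset_eq_mem (nL i)) // -?mE (m_eq i') // eL.
    - by exists 1; apply: group1.
  have L'_inj : injective L'.
    move=> i j eL; apply/eqP; case: eqVneq => // nij; case: (neqM' _ _ nij).
    apply: (@cmap_iso_span (rota_cmap (Ms' i)) (rota_cmap (Ms' j)) gT G
             (mulg^~ rho) (mulg^~ tau) (m i) (m j)) => //=.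
    - by move=> x Gx; rewrite groupM.
    - by move=> x Gx; rewrite groupM.
    - by move=> x y Gx Gy; rewrite -!mE (m_eq i) // (m_eq j) // eL.
    - by exists 1; apply: group1.
  (* Injectivity of [phi] makes the intersection of all [L'] trivial, hence contained in [L i].
     Primeness puts one [L' i'] inside [L i], and maximality of [L' i'] gives equality. *)
  have ex_i' i : exists i', L i = L' i'.
    have [|||M] := max_normal_capg nPG distP (s := codom L') (mL i).
    - by move=> M /codomP[j ->]; case/max_normalP: (mL' j).
    - by move=> M /codomP[j ->]; case/max_normalP: (mL' j) => _ /proper_sub.
    - apply/subsetP=> x; rewrite mem_capg => /andP[Px /allP Lx].
      have Gx : x \in G by apply: (subsetP (normal_sub nPG)).
      suff -> : x = 1 by apply: group1.
      apply: phi_inj => //; apply/ffunP=> j.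
      have : x \in L' j by apply/Lx/codom_f.
      by move/mker/eqP; rewrite mE -eq_mulVg1 => /eqP/esym.
    case/codomP=> i' -> sL'; exists i'; apply: group_inj.
    by have [_ _ mL'i] := max_normalP (mL' i'); apply: mL'i.
  have [sigma sigmaP] := fin_all_exists ex_i'.
  have ex_i i' : exists i, L i = L' i' by apply: L_onto.
  have [sigma' sigma'P] := fin_all_exists ex_i.
  exists sigma; split; last by move=> i; apply: iso_q.
  exists sigma' => i.
    by apply: enum_val_inj; apply: etrans (sigma'P _) _; rewrite -sigmaP.
  by apply: L'_inj; rewrite -sigmaP sigma'P.
have [K [defPK isoK]] := core_split pr_p odd_p r_ge3 p_r cG.
exists P, K; split=> //; first exact: core_abelem cG.
have uE := enum_uniq (max_normal_in G P).
have := index_capg nPG distP uE; rewrite capg_max_normal indexg1 => -> //; last first.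
  by apply/allP=> M; rewrite mem_enum.
rewrite big_enum /= expn_sum -(big_enum_val (A := mem X) (fun M : {group gT} => p ^ logn p #|P : M|)%N).
apply: eq_big => [M|M mM]; first by rewrite inE.
rewrite -card_quotient.
  have /p_natP[n /= ->] := quotient_pgroup M (core_pP cG).
  by rewrite pfactorK.
by have [nM _ _] := max_normalP mM; apply: subset_trans (normal_norm nM); apply: normal_sub.
Qed.
End Decomposition.

(** * The module P and the graph it determines *)

Record good (p r : nat) (gT : finGroupType) (G P : {group gT})
    (rho tau : gT) : Prop := Good {
  good_core : core p r G P rho tau;
  good_rho : #[rho] = (2 * p)%N;
  good_closure : forall L : {group gT}, L <| G -> rho ^+ 2 \in L -> P \subset L }.

Section GoodTheory.
Variables (p r : nat).
Hypotheses (pr_p : prime p) (odd_p : odd p) (r_ge3 : 3 <= r) (p_r : ~~ (p %| r)).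

Lemma core_rho_notin (gT : finGroupType) (G P : {group gT}) (rho tau : gT) :
  core p r G P rho tau -> rho \notin P.
Proof.
move=> cG; apply/negP=> Prho; have nPG := core_normal cG.
have defG: G \subset P * <[tau]>.
  rewrite -norm_joinEr; last first.
    by rewrite (subset_trans _ (normal_norm nPG)) // cycle_subG (core_tauG cG).
  rewrite {1}(core_gen cG) gen_subG subUset !sub1set (subsetP (joing_subl _ _)) //=.
  by rewrite (subsetP (joing_subr _ _)) ?cycle_id.
have := subset_leq_card defG; rewrite leqNgt => /negP[].
apply: (@leq_ltn_trans (#|P| * 2)%N).
  rewrite -(core_tau cG) /order (mul_cardG P <[tau]>) leq_pmulr // ?cardG_gt0.
rewrite (core_card cG) [ltnRHS]mulnC ltn_pmul2l ?cardG_gt0 //.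
by rewrite -{1}[2%N]muln1 ltn_pmul2l // (leq_trans _ r_ge3).
Qed.

(** The order [2 * p] of [rho] survives. If [z] were in [L], closure would give [P \subset L]; if
    [rho ^+ p] were in [L], the image of [rho] would be a [p]-element, hence in [P / L], against
    [core_rho_notin]. *)
Lemma good_quotient (gT : finGroupType) (G P L : {group gT}) (rho tau : gT) :
  good p r G P rho tau -> L <| G -> L \proper P ->
  good p r (G / L) (P / L) (coset L rho) (coset L tau).
Proof.
move=> gG nL pL; have cG := good_core gG; have sLP := proper_sub pL.
have nLx x : x \in G -> x \in 'N(L) by apply/subsetP/normal_norm.
have nrho := nLx _ (core_rhoG cG).
have zL: coset L rho ^+ 2 = coset L (rho ^+ 2) by rewrite morphX.
have cQ := core_quotient odd_p cG nL sLP; split=> //; last first.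
  move=> M nM; rewrite zL => zM.
  have sLG := normal_sub nL; have nPG := core_normal cG.
  rewrite -(cosetpreK M) quotientS //; apply: (good_closure gG).
    by rewrite -(quotientGK nL) /= cosetpre_normal.
  by rewrite mem_morphpre ?nLx ?groupX ?(core_rhoG cG).
have odvd: #[coset L rho] %| 2 * p.
  by rewrite order_dvdn -morphX // -(good_rho gG) expg_order morph1.
have nz: coset L rho ^+ 2 != 1.
  rewrite zL; apply/eqP => /coset_idr zLe; have/(good_closure gG nL): rho ^+ 2 \in L.
    by apply: zLe; rewrite nLx ?groupX ?(core_rhoG cG).
  by rewrite (negPf (proper_subn pL)).
have np: coset L rho ^+ p != 1.
  apply/eqP=> rp; have prr: p.-elt (coset L rho).
    by apply: (pnat_dvd (n := p)); rewrite ?order_dvdn ?rp // pnat_id.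
  have sP : <[coset L rho]>%G \subset (P / L).
    apply: (core_pgroup_sub pr_p odd_p r_ge3 p_r cQ) => //.
    by rewrite cycle_subG (core_rhoG cQ).
  by move: (core_rho_notin cQ); rewrite -cycle_subG sP.
have [o2|o2] := boolP (2 %| #[coset L rho]); last first.
  case/negP: np; rewrite -order_dvdn -(@Gauss_dvdr _ 2) //.
  by rewrite coprimen2 -[odd _]negbK -dvdn2.
case/dvdnP: o2 => m om; have mp: m %| p by move: odvd; rewrite om mulnC dvdn_pmul2l.
have /primeP[_ /(_ m mp)/orP[]/eqP em] := pr_p; last by rewrite om em mulnC.
by case/negP: nz; rewrite -order_dvdn om em.
Qed.

Section OneGroup.
Variables (gT : finGroupType) (G P : {group gT}) (rho tau : gT).
Hypothesis gG : good p r G P rho tau.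
Let cG := good_core gG.
Let nPG := core_normal cG.
Let z := rho ^+ 2.
(** The involution of [<[rho]>]; it centralises [z]. With [tau] it generates a dihedral group whose
    rotation is [c]. *)
Let h := rho ^+ p.
Let c := tau * h.
Let cPP : abelian P := abelem_abelian (core_abelem cG).
Let Grho := core_rhoG cG.
Let Gtau := core_tauG cG.
Let Pz : z \in P := core_rho2 cG.
Let Gz : z \in G. Proof. exact: groupX. Qed.
Let Gh : h \in G. Proof. exact: groupX. Qed.
Let Gc : c \in G. Proof. exact: groupM. Qed.
Let tau2 : tau * tau = 1. Proof. by rewrite -[tau * tau]/(tau ^+ 2) -(core_tau cG) expg_order. Qed.

Let order_z : #[z] = p.
Proof. by rewrite orderXdiv (good_rho gG) ?dvdn_mulr // mulKn. Qed.

Let order_h : #[h] = 2.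
Proof. by rewrite orderXdiv (good_rho gG) ?dvdn_mull // mulnK ?prime_gt0. Qed.

Let h2 : h * h = 1. Proof. by rewrite -[h * h]/(h ^+ 2) -order_h expg_order. Qed.

Let rhoE : rho = h * z ^- p./2.
Proof.
apply: (mulIg (z ^+ p./2)); rewrite mulgKV /h /z -expgM -expgS mul2n.
by rewrite -{2}(odd_double_half p) odd_p.
Qed.

Let zh : z ^ h = z.
Proof. by apply/conjg_fixP/commgP; apply: commuteX2. Qed.

Let ch : c ^ h = c^-1.
Proof.
have hV: h^-1 = h by apply: (mulgI h); rewrite mulgV h2.
have tV: tau^-1 = tau by apply: (mulgI tau); rewrite mulgV tau2.
by rewrite /c conjgE invMg hV tV !mulgA -(mulgA _ h) h2 mulg1.
Qed.

Let tauE : tau = c * h. Proof. by rewrite /c -mulgA h2 mulg1. Qed.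

Let invC u : u \in <[c]> -> u ^ h = u^-1.
Proof. by case/cycleP=> n ->; rewrite conjXg ch expgVn. Qed.

Let nPc : <[c]> \subset 'N(P).
Proof. by rewrite cycle_subG (subsetP (normal_norm nPG)). Qed.

Let norm_gen (A : {group gT}) :
  A \subset P -> c \in 'N(A) -> h \in 'N(A) -> A <| G.
Proof.
move=> sAP nc nh; rewrite /normal (subset_trans sAP (normal_sub nPG)) /=.
have nz : z \in 'N(A).
  by rewrite (subsetP _ _ Pz) // cents_norm // (sub_abelian_cent2 cPP).
rewrite (core_gen cG) gen_subG subUset !sub1set.
by rewrite {1}rhoE tauE (groupM nh) ?(groupM nc) // groupV groupX.
Qed.

(** For [w] in the intersection, [<[w]>] is centralised by [c] and inverted by [h], hence normal,
    with an invariant complement [W]. Write [z = u * x] accordingly. As [h] fixes [z] and inverts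
    [u], also [u ^+ 2] is in [W], so it is 1, and [u = 1] because [p] is odd. Then [z] is in [W], so
    [W = P] and [w = 1]. *)
Lemma good_TI : P :&: <[c]> = 1.
Proof.
apply/trivgP/subsetP=> w /setIP[Pw Cw]; rewrite inE.
have sW: <[w]>%G \subset P by rewrite cycle_subG.
have nW: <[w]>%G <| G.
  apply: norm_gen => //.
    apply: (subsetP (cent_sub _)); rewrite cent_cycle.
    by apply/cent1P; case/cycleP: Cw => n ->; apply: commuteX.
  by rewrite -cycle_subG norms_cycle invC // groupV cycle_id.
have [W [nW' eP ti]] := Maschke_abelem (core_abelem cG) nPG
   (core_coprime pr_p odd_p p_r cG) nW sW.
have sWP: W \subset P by rewrite -eP mulG_subr.
have /mulsgP[u x wu Wx ez] : z \in <[w]> * W by rewrite eP.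
have Pu: u \in P by apply: (subsetP sW).
have uC: u \in <[c]> by apply: subsetP wu; rewrite cycle_subG.
have xh: x ^ h \in W by rewrite memJ_norm // (subsetP (normal_norm nW')).
have u2: u ^+ 2 = 1.
  apply/set1gP; rewrite -ti inE groupX //=.
  have := zh; rewrite ez conjMg invC // => /(canRL (mulKVg _)) exh.
  suff -> : u ^+ 2 = x ^ h * x^-1 by rewrite groupM ?groupV.
  by rewrite exh expgS expg1 !mulgA mulgK.
have u1: u = 1.
  apply/eqP; rewrite -order_eq1 -dvdn1.
  have: coprime #[u] 2.
    have [n ->] := p_natP (mem_p_elt (core_pP cG) Pu).
    by rewrite coprimeXl // coprimen2.
  by move/eqP=> <-; rewrite dvdn_gcd dvdnn order_dvdn u2 eqxx.
have: W :&: <[w]> = <[w]>.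
  apply/setIidPr; apply: subset_trans sW _; apply: (good_closure gG nW').
  by rewrite -/z ez u1 mul1g.
by rewrite setIC ti => /esym/eqP; rewrite cycle_eq1.
Qed.

Let nPCh : <[h]> \subset 'N(P <*> <[c]>).
Proof.
rewrite normsY ?(subset_trans _ (normal_norm nPG)) ?cycle_subG //.
by rewrite -cycle_subG norms_cycle ch groupV cycle_id.
Qed.

Let defPCh : P <*> <[c]> <*> <[h]> = G.
Proof.
apply/eqP; rewrite eqEsubset !join_subG !cycle_subG Gc Gh (normal_sub nPG) /=.
set H := _ <*> _.
have Hh : h \in H by rewrite -cycle_subG joing_subr.
have HPC : P <*> <[c]> \subset H by apply: joing_subl.
have Hz : z \in H by apply: (subsetP HPC); apply: (subsetP (joing_subl _ _)).
have Hc : c \in H.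
  by apply: (subsetP HPC); apply: (subsetP (joing_subr _ _)); apply: cycle_id.
rewrite (core_gen cG) gen_subG subUset !sub1set.
by rewrite {1}rhoE tauE (groupM Hh) ?(groupM Hc) // groupV groupX.
Qed.

Let defPC : P <*> <[c]> = P * <[c]>. Proof. exact: norm_joinEr. Qed.

Let cardPC : #|P <*> <[c]>| = (#|P| * #[c])%N.
Proof. by rewrite defPC TI_cardMg ?good_TI. Qed.

(** Otherwise [G = P * <[c]>] and [c] has order [2 * r]. Writing [h = x * u], where [u] commutes
    with [c], the element [x] of [P] inverts [c]; so [c ^+ 2] is a commutator in [P :&: <[c]> = 1],
    a contradiction. *)
Let h_notin : h \notin P <*> <[c]>.
Proof.
apply/negP=> PCh.
have defG: P <*> <[c]> = G.
  by rewrite -defPCh; apply/esym/joing_idPl; rewrite cycle_subG.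
have oc: #[c] = (2 * r)%N.
  by apply/eqP; rewrite -(eqn_pmul2l (cardG_gt0 P)) -cardPC defG (core_card cG) mulnC.
have: c ^+ 2 \in P :&: <[c]>.
  rewrite inE mem_cycle andbT; move: PCh; rewrite defPC => /mulsgP[x u Px Cu eh].
  have xc: [~ x, c] \in P.
    rewrite commgEl groupM ?groupV // memJ_norm // (subsetP nPc) ?cycle_id //.
  have cu: c ^ u = c by apply/conjg_fixP/commgP; case/cycleP: Cu => n ->; apply: commuteX.
  have: c^-1 = (c ^ x) ^ u by rewrite -conjgM -eh ch.
  have cuV: c ^ u^-1 = c by rewrite -{1}cu conjgK.
  move/(congr1 (conjg^~ u^-1)); rewrite /= conjgK conjVg cuV => ecx.
  have -> : c ^+ 2 = [~ x, c]; last by [].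
  by rewrite commgEr conjVg -ecx invgK.
rewrite good_TI => /set1gP c2.
have := order_dvdn c 2; rewrite c2 eqxx oc => /idP/(dvdn_leq (isT : 0 < 2)%N).
by rewrite leqNgt -{1}[2%N]muln1 ltn_pmul2l // (leq_trans _ r_ge3).
Qed.

Let order_c : #[c] = r.
Proof.
have tih : (P <*> <[c]>) :&: <[h]> = 1.
  rewrite setIC prime_TIg ?cycle_subG //.
  by rewrite -[#|_|]/(#[h]) order_h.
have := TI_cardMg tih; rewrite -norm_joinEr // defPCh cardPC (core_card cG).
rewrite -[#|<[h]>|]/(#[h]) order_h -mulnA [(2 * _)%N]mulnC => /eqP.
by rewrite eqn_pmul2r // mulnC eqn_pmul2l ?cardG_gt0 // => /eqP.
Qed.

(** Conjugation by [h] permutes the generators, since [h] fixes [z] and inverts [<[c]>]. This makes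
    [P] cyclic over the commutative ring F_p[<c>] alone. *)
Let classC_norm : <<z ^: <[c]> >>%G <| G.
Proof.
apply: norm_gen => /=.
- rewrite gen_subG; apply/subsetP=> _ /imsetP[u Cu ->].
  by rewrite memJ_norm // (subsetP nPc).
- by rewrite (subsetP (norms_gen (class_norm _ _))) // cycle_id.
rewrite -cycle_subG norms_gen // cycle_subG inE.
apply/subsetP=> _ /imsetP[_ /imsetP[u Cu ->] ->].
by rewrite -conjgM (conjgC u) conjgM zh invC // imset_f // groupV.
Qed.

Let defP : P :=: <<z ^: <[c]> >>.
Proof.
apply/eqP; rewrite eqEsubset (good_closure gG classC_norm) ?mem_gen ?class_refl //=.
rewrite gen_subG; apply/subsetP=> _ /imsetP[u Cu ->].
by rewrite memJ_norm // (subsetP nPc).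
Qed.

(** Write [z = l * a = l' * b] along [L * A] and [L * B]. By cyclicity some ring element [beta]
    takes [z] to [b]; it maps [P] into [B] and acts trivially modulo [L]. So [beta a] lies in
    [A :&: B], hence in [L], and is congruent to [a]; thus [a] and [z] are in [L]. *)
Lemma good_distributive : distributive_in G P.
Proof.
move=> A B L nA nB nL sA sB sL sAB LA LB.
have nC (M : {group gT}) u : M <| G -> u \in <[c]> -> u \in 'N(M).
  by move=> nM; apply/subsetP; rewrite cycle_subG (subsetP (normal_norm nM)).
have /mulsgP[l a Ll Aa ez] : z \in L * A by rewrite LA.
have /mulsgP[l' b Ll' Bb ez'] : z \in L * B by rewrite LB.
have Pa := subsetP sA _ Aa.
(* The list [ks] encodes a sum of elements of [<[c]>] in the group ring; [pol ks] is its action on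
   [P], written multiplicatively. *)
pose pol (ks : seq gT) (x : gT) := foldr (fun k y => x ^ k * y) 1 ks.
have polE k ks x : pol (k :: ks) x = x ^ k * pol ks x by [].
pose inC (ks : seq gT) := {subset ks <= <[c]>}.
have inCS k ks : inC (k :: ks) -> k \in <[c]> /\ inC ks.
  by move=> kC; split=> [|u ku]; apply: kC; rewrite inE ?eqxx // ku orbT.
have polM ks (M : {group gT}) x : inC ks -> M <| G -> x \in M -> pol ks x \in M.
  move=> kC nM Mx; elim: ks kC => //= k ks IH /inCS[Ck kC].
  by rewrite groupM ?IH // memJ_norm // nC.
have polX ks x y : inC ks -> x \in P -> y \in P -> pol ks (x * y) = pol ks x * pol ks y.
  move=> kC Px Py; elim: ks kC => [_|k ks IH]; first by rewrite mulg1.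
  case/inCS=> Ck kC; rewrite !polE IH // conjMg.
  have cyx : y ^ k * pol ks x = pol ks x * y ^ k.
    by apply: (centsP cPP); [rewrite memJ_norm // nC | apply: polM].
  rewrite (mulgA _ (pol ks x)) -(mulgA (x ^ k) (y ^ k) (pol ks x)) cyx.
  by rewrite (mulgA (x ^ k) (pol ks x) (y ^ k)) -(mulgA _ (y ^ k) (pol ks y)).
have polJ ks x u : inC ks -> u \in <[c]> -> pol ks (x ^ u) = pol ks x ^ u.
  move=> kC Cu; elim: ks kC => [_|k ks IH]; first by rewrite conj1g.
  case/inCS=> Ck kC; rewrite !polE IH // (conjMg (x ^ k)) -(conjgM x u k) -(conjgM x k u).
  congr (_ ^ _ * _).
  by apply: (centsP (cycle_abelian c)).
have [ks ksC eb] : exists2 ks, inC ks & b = pol ks z.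
  have : b \in P by apply: (subsetP sB).
  rewrite defP => /gen_prodgP[n [f fC ->]] {ez'}.
  elim: n f fC => [|n IHn] f fC; first by exists [::]; rewrite ?big_ord0.
  rewrite big_ord_recl; have [k Ck ->] := imsetP (fC ord0).
  have [//|ks ksC ->] := IHn (fun i => f (lift ord0 i)).
  by exists (k :: ks) => // u; rewrite inE => /predU1P[->|/ksC].
(* As an element of F_p[<c>], beta commutes with c, so beta = 1 modulo L. *)
pose beta := pol ks.
have betaM (M : {group gT}) x : M <| G -> x \in M -> beta x \in M by apply: polM.
have betaX x y : x \in P -> y \in P -> beta (x * y) = beta x * beta y by apply: polX.
have betaJ x u : u \in <[c]> -> beta (x ^ u) = beta x ^ u by apply: polJ.
have beta1 : beta 1 = 1.
  by apply: (mulgI (beta 1)); rewrite -betaX ?group1 // !mulg1.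
have key x : x \in P -> (beta x \in B) && (beta x * x^-1 \in L).
  rewrite {1}defP => /gen_prodgP[n [f fC ->]].
  suff : [/\ \prod_(i < n) f i \in P, beta (\prod_(i < n) f i) \in B &
     beta (\prod_(i < n) f i) * (\prod_(i < n) f i)^-1 \in L] by case=> _ -> ->.
  elim: n f fC => [|n IHn] f fC; first by rewrite big_ord0 beta1 mulgV !group1.
  rewrite big_ord_recr /=; set x' := \prod_(i < n) _.
  have [//|Px' Bx' Lx'] := IHn (fun i => f (widen_ord (leqnSn n) i)); rewrite -/x' in Px' Bx' Lx'.
  have [u Cu ->] := imsetP (fC ord_max).
  have Pzu : z ^ u \in P by rewrite memJ_norm // nC.
  rewrite groupM // betaX // betaJ // -[beta z]eb.
  have bB : b ^ u \in B by rewrite memJ_norm // nC.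
  have bzL : b ^ u * (z ^ u)^-1 \in L.
    rewrite -conjVg -conjMg memJ_norm ?nC // ez' invMg mulgA mulgV mul1g groupV //.
  split=> //; first by rewrite groupM.
  rewrite invMg mulgA -(mulgA (beta x')).
  move: (_ * _^-1) bzL => w Lw; have Pw := subsetP sL w Lw.
  have -> : beta x' * w * x'^-1 = beta x' * x'^-1 * w.
    by rewrite -!mulgA; congr (_ * _); apply: (centsP cPP); rewrite ?groupV.
  by rewrite groupM.
have /andP[Bba Lba] := key a Pa.
have La : a \in L.
  have: beta a \in L by apply: (subsetP sAB); rewrite inE Bba betaM.
  by move=> Lb; rewrite -groupV -(groupMl _ Lb).
apply/eqP; rewrite eqEsubset sL; apply: (good_closure gG nL).
by rewrite -/z ez groupM.
Qed.

(** * Spans of consecutive conjugates of [z], and darts in coordinates *)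

Let w (i : nat) := z ^ (c ^+ i).
Definition zgen (a n : nat) : {group gT} := <<[set w (a + i) | i : 'I_n]>>%G.

Let Pw i : w i \in P.
Proof. by rewrite memJ_norm // (subsetP nPc) // mem_cycle. Qed.

Let mem_zgen a n i : a <= i -> i < a + n -> w i \in zgen a n.
Proof.
move=> ai ian; rewrite mem_gen //; apply/imsetP.
have lt_n: (i - a < n)%N by rewrite ltn_subLR.
by exists (Ordinal lt_n); rewrite //= subnKC.
Qed.

Let zgen_subP a n (A : {group gT}) :
  (forall i, i < n -> w (a + i) \in A) -> zgen a n \subset A.
Proof.
by move=> wA; rewrite gen_subG; apply/subsetP=> _ /imsetP[i _ ->]; apply: wA.
Qed.

Let zgenP a n : zgen a n \subset P.
Proof. by apply: zgen_subP => i _. Qed.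

Let zgenS a n a' n' : a' <= a -> a + n <= a' + n' -> zgen a n \subset zgen a' n'.
Proof.
move=> aa ann; apply: zgen_subP => i lt_i; apply: mem_zgen.
  by rewrite (leq_trans aa) ?leq_addr.
by apply: leq_trans ann; rewrite ltn_add2l.
Qed.

Let zgenJ a n b : zgen a n :^ (c ^+ b) = zgen (a + b) n.
Proof.
rewrite /zgen /= -genJ; congr <<_>>; apply/setP=> x; rewrite mem_conjg.
apply/imsetP/imsetP => -[i _ ex]; exists i => //.
  by rewrite -(conjgKV (c ^+ b) x) ex /w -conjgM -expgD addnAC.
by rewrite ex /w addnAC expgD conjgM conjgK.
Qed.

Let zgen_join a n : zgen a n.+1 :=: zgen a n * <[w (a + n)]>.
Proof.
rewrite -norm_joinEr; last first.
  by rewrite cents_norm // (sub_abelian_cent2 cPP) ?zgenP // cycle_subG.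
apply/eqP; rewrite eqEsubset join_subG cycle_subG mem_zgen ?leq_addr ?ltn_add2l //.
rewrite zgenS ?leq_add2l // !andbT; apply: (zgen_subP (A := (_ <*> _)%G)) => i.
rewrite ltnS leq_eqVlt => /predU1P[->|lt_in].
  by rewrite -cycle_subG joing_subr.
by apply: (subsetP (joing_subl _ _)); rewrite mem_zgen ?leq_addr ?ltn_add2l.
Qed.

(** As in a Krylov sequence, the first [w n] depending on its predecessors makes their span stable
    under [c]; since this span contains [z], it is [P]. Before that each step multiplies the order
    by [p]. *)
Let zgen_full n : w n \in zgen 0 n -> zgen 0 n :=: P.
Proof.
move=> wn; have nc : c \in 'N(zgen 0 n).
  rewrite inE -{1}(expg1 c) zgenJ add0n; apply: zgen_subP => i.
  rewrite leq_eqVlt add1n => /predU1P[->//|lt_in]; exact: mem_zgen.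
apply/eqP; rewrite eqEsubset zgenP {1}defP gen_subG.
have zz : z \in zgen 0 n.
  case: n wn nc => [|n] wn nc; last by rewrite -(conjg1 z) -(expg0 c) mem_zgen.
  have: w 0 \in zgen 0 0 by [].
  by rewrite /w conjg1.
apply/subsetP=> _ /imsetP[u Cu ->]; rewrite memJ_norm //.
by move: u Cu; apply/subsetP; rewrite cycle_subG.
Qed.

Let order_w i : #[w i] = p. Proof. by rewrite orderJ. Qed.

Variable s : nat.
Hypothesis cardP : #|P| = (p ^ s.+1)%N.

Let card_zgen a n : n <= s.+1 -> #|zgen a n| = (p ^ n)%N.
Proof.
suff c0 : n <= s.+1 -> #|zgen 0 n| = (p ^ n)%N.
  by rewrite -(add0n a) -zgenJ cardJg.
elim: n => [|n IHn] lt_n.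
  by apply/eqP; rewrite expn0 -trivg_card1 -subG1; apply: (zgen_subP (A := 1%G)).
rewrite zgen_join TI_cardMg.
  by rewrite IHn ?(ltnW lt_n) // -[#|<[_]>|]/(#[_]) order_w expnSr.
rewrite setIC prime_TIg -?[#|_|]/(#[_]) ?order_w // cycle_subG.
apply/negP => /zgen_full eP; have := IHn (ltnW lt_n).
rewrite eP cardP => /eqP; rewrite eqn_exp2l ?prime_gt1 // => /eqP en.
by rewrite -en ltnn in lt_n.
Qed.

Let zgen_all : zgen 0 s.+1 :=: P.
Proof. by apply/eqP; rewrite eqEcard zgenP cardP card_zgen ?leqnn. Qed.

Let zgen_cap m : m <= s -> zgen m (s.+1 - m) :&: zgen 0 s \subset zgen m (s - m).
Proof.
move=> le_ms; set A := zgen m (s.+1 - m); set B := zgen 0 s.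
have sCA : zgen m (s - m) \subset A :&: B.
  by rewrite subsetI (zgenS (leqnn m)) ?leq_add2l ?leq_sub2r //= zgenS ?subnKC.
have AB : A * B = P.
  apply/eqP; rewrite eqEsubset mul_subG ?zgenP //= -norm_joinEr; last first.
    by rewrite cents_norm // (sub_abelian_cent2 cPP) ?zgenP.
  rewrite -{1}zgen_all; apply: (zgen_subP (A := (A <*> B)%G)) => i; rewrite add0n ltnS.
  rewrite leq_eqVlt => /predU1P[->|lt_is].
    by apply: (subsetP (joing_subl _ _)); apply: mem_zgen; rewrite ?subnKC ?(leqW le_ms) //.
  by apply: (subsetP (joing_subr _ _)); apply: mem_zgen.
suff -> : A :&: B = zgen m (s - m) by [].
apply/esym/eqP; rewrite eqEcard sCA /=.
have := mul_cardG A B; rewrite AB cardP /= !card_zgen ?leq_subr // ?leqnSn //; last first.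
  by rewrite leqW ?leq_subr.
rewrite -expnD subSn // => /eqP; rewrite addSnnS expnD mulnC eqn_pmul2l; last first.
  by rewrite expn_gt0 prime_gt0.
by move/eqP<-.
Qed.

(** Lying in [zgen 0 s] means having no component along [w s], and conjugation by [c ^+ t] tests
    successive components, so [m] vanishing coordinates remove the top [m] basis vectors. For
    vertices, [m = s] leaves [<[z]>]; for edges, [m = s.+1] leaves 1. *)
Let zgen_cut m x : m <= s.+1 -> x \in P ->
  (forall t, t < m -> x ^ (c ^+ t) \in zgen 0 s) -> x \in zgen 0 (s.+1 - m).
Proof.
move=> le_m Px; elim: m le_m => [|m IHm] le_m xz; first by rewrite subn0 zgen_all.
have := IHm (ltnW le_m) (fun t lt_t => xz t (leqW lt_t)) => xm.
rewrite subSS -(memJ_conjg _ (c ^+ m)) zgenJ add0n.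
apply: (subsetP (zgen_cap _)) => //.
by rewrite inE xz // andbT -[X in zgen X]add0n -zgenJ memJ_conjg.
Qed.
Let r_gt0 : 0 < r. Proof. exact: leq_trans r_ge3. Qed.

Let PC_sub : P <*> <[c]> \subset G.
Proof. by rewrite join_subG (normal_sub nPG) cycle_subG. Qed.

Let PC_index : #|G : P <*> <[c]>| = 2.
Proof.
apply/eqP; rewrite -(eqn_pmul2l (cardG_gt0 (P <*> <[c]>))) (Lagrange PC_sub).
by rewrite cardPC order_c (core_card cG) -mulnA mulnC [(r * _)%N]mulnC.
Qed.

Let PC_mem x i : x \in P -> x * c ^+ i \in P <*> <[c]>.
Proof.
move=> Px; rewrite groupM //; first exact: (subsetP (joing_subl _ _)).
by apply: (subsetP (joing_subr _ _)); apply: mem_cycle.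
Qed.

Let PC_dec g : g \in P <*> <[c]> -> exists x (i : 'I_r), x \in P /\ g = x * c ^+ i.
Proof.
rewrite defPC => /mulsgP[x _ Px /cycleP[n ->] ->].
exists x, (Ordinal (ltn_pmod n r_gt0)); split=> //=.
by rewrite -order_c expg_mod_order.
Qed.

(** Used with [y = h] for vertices and [y = tau] for edges. Both lie outside the subgroup [P <*>
    <[c]>] of index 2, so each [g] in [G] is [x * c ^+ i * y ^+ b] in exactly one way, and the
    default value does not occur on [G]. *)
Let coord (y g : gT) : gT * 'I_r * bool :=
  odflt (1, Ordinal r_gt0, false)
    [pick t : gT * 'I_r * bool | (t.1.1 \in P) && (g == t.1.1 * c ^+ t.1.2 * y ^+ t.2)].

Let coord_dec y g : y \in G -> y \notin P <*> <[c]> -> g \in G ->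
  exists x (i : 'I_r) (b : bool), x \in P /\ g = x * c ^+ i * y ^+ b.
Proof.
move=> Gy nPCy Gg; have [PCg|nPCg] := boolP (g \in P <*> <[c]>).
  have [x [i [Px ->]]] := PC_dec PCg; exists x, i, false.
  by rewrite expg0 mulg1.
have: g \in (P <*> <[c]>) :* y.
  by rewrite (rcoset_index2 PC_sub PC_index) ?inE ?nPCy ?nPCg.
case/rcosetP=> g' /PC_dec[x [i [Px ->]]] ->; exists x, i, true.
by rewrite expg1.
Qed.

Let coordE y x (i : 'I_r) (b : bool) : y \notin P <*> <[c]> -> x \in P ->
  coord y (x * c ^+ i * y ^+ b) = (x, i, b).
Proof.
move=> nPCy Px; rewrite /coord; case: pickP => [[[x' i'] b'] /= /andP[Px' /eqP]|]; last first.
  by move/(_ (x, i, b)); rewrite /= Px eqxx.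
have eqb : x * c ^+ i * y ^+ b = x' * c ^+ i' * y ^+ b' -> b = b'.
  move=> e; apply/eqP; apply: contraR nPCy => nb.
  have PC1 := PC_mem i Px; have PC2 := PC_mem i' Px'.
  move: nb e; case: b; case: b' => //= _; rewrite ?expg1 ?expg0 ?mulg1 => e.
    by rewrite -(groupMl _ PC1) e.
  by rewrite -(groupMl _ PC2) -e.
move=> e; have eb := eqb e; move: e; rewrite -eb => /mulIg e.
have e2 : x'^-1 * x = c ^+ i' * c ^- i.
  by apply: (mulIg (c ^+ i)); rewrite mulgKV -mulgA e mulKg.
have /set1gP x1 : x'^-1 * x \in [1 gT].
  rewrite -good_TI inE groupM ?groupV //= e2 groupM ?groupV ?mem_cycle //.
have ex : x = x' by apply/eqP; rewrite eq_sym eq_mulVg1 x1.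
move: e; rewrite ex => /mulgI/eqP; rewrite eq_expg_mod_order order_c !modn_small //.
by move/eqP/val_inj->.
Qed.

Let tau_notin : tau \notin P <*> <[c]>.
Proof.
rewrite tauE; apply: contra h_notin; rewrite groupMl //.
by apply: (subsetP (joing_subr _ _)); apply: cycle_id.
Qed.

Lemma good_PX : rota_graph_iso (RData G rho tau) (@PXinc p r s).
Proof.
have indexH : #|lcosets (zgen 0 s) P| = p.
  rewrite card_lcosets; apply/eqP.
  rewrite -(eqn_pmul2l (cardG_gt0 (zgen 0 s))) (Lagrange (zgenP _ _)) cardP.
  by rewrite card_zgen // expnSr.
have lH1 : 1 *: zgen 0 s \in lcosets (zgen 0 s) P.
  by apply/imsetP; exists 1; rewrite ?lcosetE.
pose beta x : 'I_p := cast_ord indexH (enum_rank_in lH1 (x *: zgen 0 s)).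
have betaE x y : x \in P -> y \in P -> (beta x == beta y) = (x^-1 * y \in zgen 0 s).
  move=> Px Py; rewrite -lcoset_eqE (inj_eq (@cast_ord_inj _ _ _)).
  have lx u : u \in P -> u *: zgen 0 s \in lcosets (zgen 0 s) P.
    by move=> Pu; apply/imsetP; exists u; rewrite ?lcosetE.
  by apply/eqP/eqP => [/enum_rank_in_inj->|->] //; apply: lx.
have PJ x n : x \in P -> x ^ (c ^+ n) \in P.
  by move=> Px; rewrite memJ_norm // (subsetP nPc) ?mem_cycle.
have betaJ x y n : x \in P -> y \in P ->
    (beta (x ^ (c ^+ n)) == beta (y ^ (c ^+ n))) = ((x^-1 * y) ^ (c ^+ n) \in zgen 0 s).
  by move=> Px Py; rewrite betaE ?PJ // conjMg conjVg.
(* With exponent [i + t], keeping [x] and passing from level [i] to the next shifts the tuple by one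
   place, as along a PX edge. *)
pose cl n x (i : 'I_r) : {ffun 'I_n -> 'I_p} := [ffun t : 'I_n => beta (x ^ (c ^+ (i + t)))].
pose Fv g : PXV p r s := ((coord h g).1.2, cl s (coord h g).1.1 (coord h g).1.2).
pose Fe g : PXE p r s := ((coord tau g).1.2, cl s.+1 (coord tau g).1.1 (coord tau g).1.2).
have FvE x (i : 'I_r) (b : bool) : x \in P -> Fv (x * c ^+ i * h ^+ b) = (i, cl s x i).
  by move=> Px; rewrite /Fv coordE.
have FeE x (i : 'I_r) (b : bool) : x \in P -> Fe (x * c ^+ i * tau ^+ b) = (i, cl s.+1 x i).
  by move=> Px; rewrite /Fe coordE.
have clE n x y (i : 'I_r) : n <= s.+1 -> x \in P -> y \in P -> cl n x i = cl n y i ->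
    (x^-1 * y) ^ (c ^+ i) \in zgen 0 (s.+1 - n).
  move=> le_n Px Py /ffunP e; apply: zgen_cut; rewrite ?PJ ?groupM ?groupV //.
  move=> t lt_t; rewrite -conjgM -expgD -betaJ //.
  by have := e (Ordinal lt_t); rewrite !ffunE /= => ->.
have cx (x : gT) i : c ^+ i * x = x ^ (c ^- i) * c ^+ i.
  by rewrite [RHS]conjgC conjgKV.
have hh (b : bool) : h ^+ b * h = h ^+ (~~ b) by case: b => //; rewrite expg0 mul1g.
have tt (b : bool) : tau ^+ b * tau = tau ^+ (~~ b) by case: b => //; rewrite expg0 mul1g.
(* By [rhoE], right multiplication by [rho] flips [b] and changes [x] by a conjugate of a power of
   [z]; the [t]-th coordinate of this change is the class of a power of [w t], which vanishes for
   [t < s]. *)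
have Fvr g : g \in G -> Fv (g * rho) = Fv g.
  move=> Gg; have [x [i [b [Px ->]]]] := coord_dec Gh h_notin Gg.
  rewrite FvE // {1}rhoE mulgA -(mulgA _ _ h) hh -(mulgA _ (h ^+ _)).
  have hz : h ^+ (~~ b) * z ^- p./2 = z ^- p./2 * h ^+ (~~ b).
    by apply/commuteV/commuteX; apply: commute_sym; apply: commuteX; apply: commuteX2.
  have Pzi : (z ^- p./2) ^ (c ^- i) \in P.
    have nci : c ^- i \in 'N(P) by rewrite groupV (subsetP nPc) ?mem_cycle.
    by rewrite memJ_norm // groupV groupX.
  rewrite hz mulgA -(mulgA x) cx mulgA FvE; last by rewrite groupM.
  congr (_, _); apply/ffunP=> t; rewrite !ffunE; apply/eqP.
  rewrite eq_sym betaJ //; last by rewrite groupM.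
  rewrite mulKg -conjgM expgD mulKg conjVg conjXg groupV.
  by rewrite groupX // mem_zgen.
have Fet g : g \in G -> Fe (g * tau) = Fe g.
  move=> Gg; have [x [i [b [Px ->]]]] := coord_dec Gtau tau_notin Gg.
  by rewrite -(mulgA _ _ tau) tt !FeE.
apply: (@rota_graph_isoI (RData G rho tau) _ _ (@ptail p r s) (@phead p r s) _
   (@PXincE p r s) _ Fv Fe) => /=.
- by split; [exact: core_gen cG | exact: core_tau cG].
- move=> g g' Gg Gg'; apply/eqP/idP => [|]; last first.
    case/cycleP=> n /(canRL (mulKVg g)) ->; elim: n => [|n IHn]; first by rewrite mulg1.
    by rewrite expgSr mulgA Fvr ?groupM ?groupX.
  have [x [i [b [Px ->]]]] := coord_dec Gh h_notin Gg.
  have [y [j [b' [Py ->]]]] := coord_dec Gh h_notin Gg'.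
  rewrite !FvE // => -[<-] /(clE _ _ _ _ (leqnSn s) Px Py).
  rewrite subSnn => xy.
  have {}xy : (x^-1 * y) ^ (c ^+ i) \in <[rho]>.
    apply: subsetP xy; apply: zgen_subP => -[|//] _.
    by rewrite /w conjg1 mem_cycle.
  have -> : (x * c ^+ i * h ^+ b)^-1 * (y * c ^+ i * h ^+ b') =
      (h ^+ b)^-1 * (x^-1 * y) ^ (c ^+ i) * h ^+ b' by rewrite !invMg conjgE !mulgA.
  have hR n : h ^+ n \in <[rho]> by rewrite groupX // mem_cycle.
  by apply: groupM => //; apply: groupM => //; rewrite groupV.
- move=> g g' Gg Gg'; apply/eqP/idP => [|]; last first.
    case/cycleP=> n /(canRL (mulKVg g)) ->; elim: n => [|n IHn]; first by rewrite mulg1.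
    by rewrite expgSr mulgA Fet ?groupM ?groupX.
  have [x [i [b [Px ->]]]] := coord_dec Gtau tau_notin Gg.
  have [y [j [b' [Py ->]]]] := coord_dec Gtau tau_notin Gg'.
  rewrite !FeE // => -[<-] /(clE _ _ _ _ (leqnn s.+1) Px Py).
  rewrite subnn => xy.
  have /set1gP : (x^-1 * y) ^ (c ^+ i) \in 1%G by apply: subsetP xy; apply: zgen_subP.
  move/(canRL (conjgK _)); rewrite conj1g => /eqP.
  rewrite -eq_mulVg1 => /eqP <-.
  rewrite !invMg -!mulgA (mulgA x^-1) mulVg mul1g mulKg.
  by rewrite groupM ?groupV ?groupX ?cycle_id.
- apply/eqP; rewrite -(eqn_pmul2l (cardG_gt0 <[rho]>)) Lagrange ?cycle_subG //.
  rewrite -[#|<[rho]>|]/(#[rho]) (good_rho gG) (core_card cG) cardP.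
  by rewrite card_prod card_ffun !card_ord expnS -!mulnA; apply/eqP; congr (_ * _)%N; rewrite mulnCA.
- apply/eqP; rewrite -(eqn_pmul2l (cardG_gt0 <[tau]>)) Lagrange ?cycle_subG //.
  rewrite -[#|<[tau]>|]/(#[tau]) (core_tau cG) (core_card cG) cardP.
  by rewrite card_prod card_ffun !card_ord -mulnA.
move=> g Gg; have [x [i [b [Px ->]]]] := coord_dec Gtau tau_notin Gg.
have Ft : Fv (x * c ^+ i) = ptail (Fe (x * c ^+ i * tau ^+ b)).
  rewrite FeE // -(mulg1 (x * c ^+ i)) -(expg0 h) (FvE _ _ false) //; congr (_, _).
  by apply/ffunP=> t; rewrite !ffunE.
have cmod n : c ^+ (n %% r) = c ^+ n by rewrite -{1}order_c expg_mod_order.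
(* As [tau = c * h], the other end of the dart [x * c ^+ i] is the vertex of [x * c ^+ i.+1 * h]:
   same [x], one level up. *)
have Fh : Fv (x * c ^+ i * tau) = phead (Fe (x * c ^+ i * tau ^+ b)).
  rewrite FeE // tauE mulgA -(mulgA x) -expgSr -(cmod i.+1).
  rewrite -[h]expg1 (FvE x (ordS i) true) //; congr (_, _).
  by apply/ffunP=> t; rewrite !ffunE /= expgD cmod -expgD addSnnS.
case: b Ft Fh; rewrite ?expg0 ?expg1 ?mulg1 => Ft Fh; [right | left]; split=> //.
by rewrite -(mulgA _ tau) tau2 mulg1.
Qed.

End OneGroup.
End GoodTheory.

Section GoodDecomposition.
Variables (p r : nat).
Hypotheses (pr_p : prime p) (odd_p : odd p) (r_ge3 : 3 <= r) (p_r : ~~ (p %| r)).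
Variables (gT : finGroupType) (G P : {group gT}) (rho tau : gT).
Hypothesis gG : good p r G P rho tau.

Lemma good_nontrivial : P :!=: 1.
Proof.
apply/eqP=> P1; have := core_rho2 (good_core gG).
rewrite P1 => /set1gP /eqP; rewrite -order_dvdn (good_rho gG) => /(dvdn_leq (isT : 0 < 2)%N).
by rewrite leqNgt -{1}[2%N]muln1 ltn_pmul2l // prime_gt1.
Qed.

Lemma good_aug_PX : is_aug_PX p r (RData G rho tau).
Proof.
have /p_natP[d cardP] := core_pP (good_core gG).
case: d cardP => [|s] cardP.
  by case/eqP: good_nontrivial; apply: card1_trivg.
have := good_PX pr_p odd_p r_ge3 p_r gG cardP.
case: s {cardP} => [|s] iso; first by right; left; apply/MC_PX0.
by left; exists s.+1.
Qed.
End GoodDecomposition.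

(** * From the PX graph to the group *)

Section PXgroup.
Variables (p r0 s : nat).
(** In this form ['I_r] carries the ring Z/r, in which levels and signs are computed. *)
Local Notation r := r0.+2.
Hypotheses (pr_p : prime p) (r_ge3 : 3 <= r).
Variables (gT : finGroupType) (G : {group gT}) (rho tau : gT).
Variables (Fv : gT -> PXV p r s) (Fe : gT -> PXE p r s).
Hypotheses (defG : G :=: <<[set rho; tau]>>) (order_tau : #[tau] = 2).
Hypothesis FvE : {in G &, forall x y, (Fv x == Fv y) = (x^-1 * y \in <[rho]>)}.
Hypothesis FeE : {in G &, forall x y, (Fe x == Fe y) = (x^-1 * y \in <[tau]>)}.
Hypothesis Fv_onto : forall v, exists2 x, x \in G & Fv x = v.
Hypothesis Fe_onto : forall e, exists2 x, x \in G & Fe x = e.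
Hypothesis ends : {in G, forall x,
  Fv x = ptail (Fe x) /\ Fv (x * tau) = phead (Fe x) \/
  Fv x = phead (Fe x) /\ Fv (x * tau) = ptail (Fe x)}.
Hypothesis order_rho : #[rho] = (2 * p)%N.
Hypothesis cardG : #|G| = (2 * r * p ^ s.+1)%N.

Definition outward g : bool := Fv g == ptail (Fe g).
Local Notation d := outward.
Local Notation z := (rho ^+ 2).
Let lev g : 'I_r := (Fv g).1.
Let y g (t : nat) : 'I_p := (Fe g).2 (inord t).

Let Grho : rho \in G. Proof. by rewrite defG mem_gen // !inE eqxx. Qed.
Let Gtau : tau \in G. Proof. by rewrite defG mem_gen // !inE eqxx orbT. Qed.
Let Gz : z \in G. Proof. exact: groupX. Qed.

Let ordS_neq (i : 'I_r) : ordS i != i.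
Proof.
apply/eqP => /(congr1 val) /=; have := ltn_ord i; rewrite leq_eqVlt.
case/predU1P=> [e|lt_i]; last by rewrite modn_small // => /esym/n_Sn.
by rewrite e modnn => i0; move: e; rewrite -i0.
Qed.

Let tail_neq_head (e : PXE p r s) : ptail e != phead e.
Proof. by rewrite xpair_eqE negb_and eq_sym ordS_neq. Qed.

Lemma Fe_tau g : g \in G -> Fe (g * tau) = Fe g.
Proof. by move=> Gg; apply/esym/eqP; rewrite FeE // ?mulKg ?cycle_id // groupM. Qed.

Lemma Fv_rho g n : g \in G -> Fv (g * rho ^+ n) = Fv g.
Proof.
by move=> Gg; apply/esym/eqP; rewrite FvE // ?mulKg ?mem_cycle // groupM // groupX.
Qed.

Lemma outward_tail g : d g -> Fv g = ptail (Fe g). Proof. by move/eqP. Qed.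

Lemma inward_head g : g \in G -> ~~ d g -> Fv g = phead (Fe g).
Proof. by move=> Gg; case: (ends Gg) => [] [e _] //; rewrite /outward e eqxx. Qed.

Lemma outward_tau g : g \in G -> d (g * tau) = ~~ d g.
Proof.
move=> Gg; rewrite /outward Fe_tau //.
by case: (ends Gg) => [] [-> ->]; rewrite eqxx ?(negPf (tail_neq_head _)) // eq_sym
   (negPf (tail_neq_head _)).
Qed.

Lemma dart_inj g g' : g \in G -> g' \in G -> d g = d g' -> Fe g = Fe g' -> g = g'.
Proof.
move=> Gg Gg' dgg' /eqP; rewrite FeE // (cycle2g order_tau) !inE => /orP[]/eqP e.
  by apply/eqP; rewrite eq_mulVg1 e eqxx.
by move: dgg'; rewrite -(mulKVg g g') e outward_tau //; case: (d g).
Qed.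

Lemma dart_onto e b : exists g, [/\ g \in G, Fe g = e & d g = b].
Proof.
have [g Gg eg] := Fe_onto e; have [db|db] := boolP (d g == b).
  by exists g; split=> //; rewrite (eqP db).
exists (g * tau); rewrite groupM // Fe_tau // outward_tau //; split=> //.
by move: db; case: (d g); case: b.
Qed.

Let FvJ g x x' : g \in G -> x \in G -> x' \in G -> Fv x = Fv x' -> Fv (g * x) = Fv (g * x').
Proof.
move=> Gg Gx Gx' /eqP; rewrite FvE // => xx'; apply/eqP; rewrite FvE ?(groupM Gg) //.
by rewrite invMg -mulgA mulKg.
Qed.

Let FvJK g x x' : g \in G -> x \in G -> x' \in G -> Fv (g * x) = Fv (g * x') -> Fv x = Fv x'.
Proof.
move=> Gg Gx Gx' e; have := FvJ (groupVr Gg) (groupM Gg Gx) (groupM Gg Gx') e.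
by rewrite !mulKg.
Qed.

(** * Why [rho] exchanges forward and backward edges *)

Definition adjacent (v w : PXV p r s) : Prop :=
  exists e, v = ptail e /\ w = phead e \/ v = phead e /\ w = ptail e.

(** Left multiplication is a graph automorphism, but it may exchange tails and heads; hence only the
    unoriented relation is transported. *)
Let adjacentJ g x x' : g \in G -> x \in G -> x' \in G ->
  adjacent (Fv x) (Fv x') -> adjacent (Fv (g * x)) (Fv (g * x')).
Proof.
move=> Gg Gx Gx' [e ex]; have [u [Gu eu du]] := dart_onto e true.
have [vu vut] : Fv u = ptail e /\ Fv (u * tau) = phead e.
  have dut : ~~ d (u * tau) by rewrite outward_tau ?du.
  by rewrite outward_tail ?du // (inward_head (groupM Gu Gtau) dut) Fe_tau // eu.
exists (Fe (g * u)); have Gut : u * tau \in G by rewrite groupM.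
have eg := ends (groupM Gg Gu); rewrite -mulgA in eg.
case: ex => [] [e1 e2].
  have -> : Fv (g * x) = Fv (g * u) by apply: FvJ; rewrite ?vu.
  by have -> : Fv (g * x') = Fv (g * (u * tau)) by apply: FvJ; rewrite ?vut.
have -> : Fv (g * x') = Fv (g * u) by apply: FvJ; rewrite ?vu.
have -> : Fv (g * x) = Fv (g * (u * tau)) by apply: FvJ; rewrite ?vut.
by case: eg => [] [-> ->]; [right|left].
Qed.

(* An invariant relation telling the two sides of a vertex apart forces rho to swap them. *)
Lemma outward_rho_of_rel (Rel : PXV p r s -> PXV p r s -> Prop) :
  (forall g x x', g \in G -> x \in G -> x' \in G ->
     Rel (Fv x) (Fv x') -> Rel (Fv (g * x)) (Fv (g * x'))) ->
  (forall v w, Rel v w -> Rel w v) ->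
  (forall e e', ptail e = ptail e' -> Rel (phead e) (phead e')) ->
  (forall e e', phead e = phead e' -> Rel (ptail e) (ptail e')) ->
  (forall e e', ptail e = phead e' -> ~ Rel (phead e) (ptail e')) ->
  forall g, g \in G -> d (g * rho) = ~~ d g.
Proof.
move=> RelJ RelC Rel_out Rel_in Rel_opp.
have far g : g \in G -> Fv (g * tau) = if d g then phead (Fe g) else ptail (Fe g).
  move=> Gg; rewrite -(Fe_tau Gg); case dg: (d g).
    by rewrite inward_head ?groupM ?outward_tau ?dg.
  by rewrite outward_tail ?outward_tau ?dg.
have near g : g \in G -> Fv g = if d g then ptail (Fe g) else phead (Fe g).
  by move=> Gg; case dg: (d g); [rewrite outward_tail | rewrite inward_head ?dg].
have RelP g g' : g \in G -> g' \in G -> Fv g = Fv g' ->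
    Rel (Fv (g * tau)) (Fv (g' * tau)) <-> d g = d g'.
  move=> Gg Gg'; rewrite !far // (near g) // (near g') //.
  case: (d g); case: (d g') => e; split=> // R.
  - exact: Rel_out.
  - by case: (Rel_opp _ _ e).
  - by case: (Rel_opp _ _ (esym e)); apply: RelC.
  - exact: Rel_in.
have Fvr g : g \in G -> Fv (g * rho) = Fv g by move=> Gg; rewrite -[rho]expg1 Fv_rho.
have Grt : rho * tau \in G by rewrite groupM.
(* Through [RelP], whether [rho] keeps the direction of a dart becomes a question about the
   invariant [Rel], with the same answer at all darts. *)
have same g : g \in G -> d (g * rho) = d g <-> d rho = d 1.
  move=> Gg; have Gr : g * rho \in G by rewrite groupM.
  rewrite -(RelP (g * rho) g) ?Fvr // -(RelP rho 1) //; last by rewrite -[rho]mul1g Fvr.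
  rewrite -mulgA mul1g; split=> R; last exact: RelJ.
  by have := RelJ _ _ _ (groupVr Gg) (groupM Gg Grt) (groupM Gg Gtau) R; rewrite !mulKg.
suff ne1 : d rho <> d 1.
  move=> g Gg; have := same g Gg; case: (d (g * rho)); case: (d g) => // -[] H _;
  by case: ne1; apply: H.
move=> e1; have dn g n : g \in G -> d (g * rho ^+ n) = d g.
  move=> Gg; elim: n => [|n IHn]; first by rewrite mulg1.
  by rewrite expgSr mulgA -IHn; apply/same => //; rewrite groupM ?groupX.
have [x [Gx _ dx]] := dart_onto (Fe 1) true.
(* An edge entering the vertex that [x] leaves: the tuple of [Fe x] moved up one place, with an
   arbitrary entry 0. If [rho] kept directions, all darts at this vertex would point outward. *)
pose e' : PXE p r s := (ord_pred (Fe x).1, [ffun t : 'I_s.+1 => (Fe x).2 (inord t.-1)]).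
have [x' [Gx' ex' dx']] := dart_onto e' false.
have exx' : Fv x = Fv x'.
  rewrite (near x) // (near x') // dx dx' ex' /phead /ptail /= ord_predK; congr (_, _).
  apply/ffunP=> j; rewrite !ffunE; congr (_ _); apply: val_inj => /=.
  by rewrite inordK add0n // ltnS ltnW.
have := FvE Gx Gx'; rewrite exx' eqxx => /esym/cycleP[n en].
by have := dn x n Gx; rewrite -en mulKVg dx dx'.
Qed.

Let val_iter_ordS n (i : 'I_r) : val (iter n (@ordS r) i) = ((i + n) %% r)%N.
Proof.
elim: n => [|n IHn] /=; first by rewrite addn0 modn_small.
by rewrite IHn -addn1 modnDml addn1 addnS.
Qed.

Let iter_ordS_neq n (i : 'I_r) : ~~ (r %| n) -> iter n (@ordS r) i != i.
Proof.
apply: contraNneq => /(congr1 val); rewrite val_iter_ordS => e.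
have : i + n == i + 0 %[mod r] by rewrite addn0 e modn_small.
by rewrite eqn_modDl mod0n.
Qed.

Let ordS2_neq (i : 'I_r) : ordS (ordS i) != i.
Proof. by apply: (@iter_ordS_neq 2); apply/negP => /(dvdn_leq (isT : 0 < 2)%N); rewrite leqNgt r_ge3. Qed.

Lemma outward_rho_s0 : s = 0%N -> forall g, g \in G -> d (g * rho) = ~~ d g.
Proof.
move=> s0; apply: (outward_rho_of_rel (Rel := eq)) => //.
- move=> e e' /(congr1 fst)/= e1; rewrite /phead e1; congr (_, _); apply/ffunP=> j.
  by have := ltn_ord j; rewrite {2}s0.
- move=> e e' /(congr1 fst)/= e1; rewrite /ptail (ordS_inj e1); congr (_, _); apply/ffunP=> j.
  by have := ltn_ord j; rewrite {2}s0.
by move=> e e' /(congr1 fst)/= e1 /(congr1 fst)/= e2; case/eqP: (ordS2_neq e'.1); rewrite -e1 e2.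
Qed.

(** The relation is having the same neighbours: for [s = 1] consecutive levels are completely
    joined. If [r = 4], the levels before and after a vertex have the same neighbours, so the two
    sides are not separated. *)
Lemma outward_rho_s1 : s = 1%N -> r != 4 -> forall g, g \in G -> d (g * rho) = ~~ d g.
Proof.
move=> s1 r4; pose Rel v w := forall u, adjacent v u <-> adjacent w u.
have adjP v w : adjacent v w <-> w.1 = ordS v.1 \/ v.1 = ordS w.1.
  split=> [[e []] [-> ->]|]; [by left | by right | ].
  have j0 : 'I_s by rewrite s1; apply: ord0.
  have jz (j : 'I_s) : val j = 0%N.
    by case: j => -[|k] //= lk; exfalso; move: lk; rewrite s1.
  have j0E j : j = j0 by apply: val_inj; rewrite !jz.
  have mk (a b : PXV p r s) : b.1 = ordS a.1 -> exists e, a = ptail e /\ b = phead e.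
    case: a b => [i a] [j b] /= ->.
    exists (i, [ffun t : 'I_s.+1 => if t == 0%N :> nat then a j0 else b j0]).
    rewrite /ptail /phead /=; split; congr (_, _); apply/ffunP=> t; rewrite !ffunE (j0E t) //=.
    by have -> : nat_of_ord j0 = 0%N by apply: jz.
  by case=> /mk[e [-> ->]]; exists e; [left | right].
apply: (outward_rho_of_rel (Rel := Rel)).
- move=> g x x' Gg Gx Gx' R u; have [w Gw <-] := Fv_onto u.
  have Gw' : g^-1 * w \in G by rewrite groupM ?groupV.
  rewrite -(mulKVg g w); move: (g^-1 * w) Gw' => w' Gw'.
  have adjJ a : a \in G -> adjacent (Fv (g * a)) (Fv (g * w')) <-> adjacent (Fv a) (Fv w').
    move=> Ga; split=> [A|]; last exact: adjacentJ.
    by have := adjacentJ (groupVr Gg) (groupM Gg Ga) (groupM Gg Gw') A; rewrite !mulKg.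
  by rewrite !adjJ.
- by move=> v w R u; split=> /R.
- by move=> e e' /(congr1 fst)/= e1 u; rewrite !adjP /= e1.
- by move=> e e' /(congr1 fst)/= /ordS_inj e1 u; rewrite !adjP /= e1.
move=> e e' /(congr1 fst)/= e1 R.
pose u : PXV p r s := (ordS (ordS e.1), (ptail e).2).
have : adjacent (phead e) u by apply/adjP; left.
move/R/adjP=> /= [|/esym]; rewrite e1.
  by move/ordS_inj/eqP; rewrite (negPf (ordS2_neq _)).
apply/eqP; apply: (@iter_ordS_neq 4).
have ndvd n : 3 <= n -> n != 4 -> ~~ (n %| 4).
  by case: n => [|[|[|[|[|n]]]]] // _ _; rewrite gtnNdvd.
exact: ndvd.
Qed.

Definition succ_of (v w : PXV p r s) : Prop :=
  w.1 = ordS v.1 /\ forall i j : 'I_s, j = i.+1 :> nat -> w.2 i = v.2 j.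

Let succ_of_edge (e : PXE p r s) : succ_of (ptail e) (phead e).
Proof.
split=> // i j ij; rewrite !ffunE; congr (_ _); apply: val_inj => /=.
by rewrite ij.
Qed.

Let succ_of_uniq a b w w' : 2 <= s ->
  succ_of a w -> succ_of w b -> succ_of a w' -> succ_of w' b -> w = w'.
Proof.
move=> s2 [l1 aw] [_ wb] [l1' aw'] [_ wb'].
rewrite [LHS]surjective_pairing [RHS]surjective_pairing l1 l1'; congr (_, _).
apply/ffunP=> j; case: (ltnP j.+1 s) => [lt_j|le_j].
  by rewrite (aw j (Ordinal lt_j)) // (aw' j (Ordinal lt_j)).
have j_gt0 : 0 < j by rewrite -ltnS (leq_trans s2).
have lt_j : j.-1 < s by rewrite prednK // ltnW.
by rewrite -(wb (Ordinal lt_j) j) ?(wb' (Ordinal lt_j) j) //= prednK.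
Qed.

(** The relation is having three common neighbours. Vertices on the same side of a vertex have [p]
    of them, found by varying an end coordinate. Vertices on opposite sides have at most two: a
    common neighbour succeeds one and precedes the other, and [succ_of_uniq] allows one for each
    order. *)
Lemma outward_rho_s2 : 2 <= s -> 3 <= p -> forall g, g \in G -> d (g * rho) = ~~ d g.
Proof.
move=> s2 p3; have p0 : 0 < p by apply: leq_trans p3.
have p1 : 1 < p by apply: leq_trans p3.
pose com u v w := adjacent u w /\ adjacent v w.
pose Rel u v := exists w1 w2 w3,
  [/\ w1 != w2, w1 != w3, w2 != w3 & [/\ com u v w1, com u v w2 & com u v w3]].
have adjC v w : adjacent v w -> adjacent w v.
  by case=> e [] [-> ->]; exists e; [right | left].
have mkRel u v (f : 'I_p -> PXV p r s) : injective f -> (forall a, com u v (f a)) -> Rel u v.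
  move=> f_inj fc; exists (f (Ordinal p0)), (f (Ordinal p1)), (f (Ordinal p3)).
  by split=> //; rewrite (inj_eq f_inj).
have lt0s : 0 < s by apply: leq_trans s2.
apply: (outward_rho_of_rel (Rel := Rel)).
- move=> g x x' Gg Gx Gx' [w1 [w2 [w3 [n12 n13 n23 [c1 c2 c3]]]]].
  have [[x1 G1 e1] [x2 G2 e2] [x3 G3 e3]] := And3 (Fv_onto w1) (Fv_onto w2) (Fv_onto w3).
  rewrite -{}e1 -{}e2 -{}e3 in n12 n13 n23 c1 c2 c3.
  exists (Fv (g * x1)), (Fv (g * x2)), (Fv (g * x3)).
  have neqJ a b : a \in G -> b \in G -> Fv a != Fv b -> Fv (g * a) != Fv (g * b).
    by move=> Ga Gb; apply: contra_neq; apply: FvJK.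
  have comJ a : a \in G -> com (Fv x) (Fv x') (Fv a) ->
      com (Fv (g * x)) (Fv (g * x')) (Fv (g * a)).
    by move=> Ga [A1 A2]; split; apply: adjacentJ.
  by split; try split; auto.
- move=> v w [w1 [w2 [w3 [n12 n13 n23 [[? ?] [? ?] [? ?]]]]]].
  by exists w1, w2, w3; split=> //; split.
- move=> e e' te; have /= e1 := congr1 fst te; have /= /ffunP e2 := congr1 snd te.
  pose ea (e : PXE p r s) a : PXE p r s :=
    (e.1, [ffun t : 'I_s.+1 => if t == 0%N :> nat then a else e.2 t]).
  have hea e0 a : phead (ea e0 a) = phead e0.
    by congr (_, _); apply/ffunP=> t; rewrite !ffunE.
  have tea a : ptail (ea e a) = ptail (ea e' a).
    rewrite /ptail /= e1; congr (_, _); apply/ffunP=> t; rewrite !ffunE /=.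
    by case: eqP => // _; have := e2 t; rewrite !ffunE.
  apply: (mkRel _ _ (fun a => ptail (ea e a))).
    by move=> a b /(congr1 snd)/= /ffunP/(_ (Ordinal lt0s)); rewrite !ffunE.
  move=> a; split; first by exists (ea e a); right; rewrite hea.
  by exists (ea e' a); right; rewrite hea tea.
- move=> e e' he; have /= /ordS_inj e1 := congr1 fst he; have /= /ffunP e2 := congr1 snd he.
  pose ea (e : PXE p r s) a : PXE p r s :=
    (e.1, [ffun t : 'I_s.+1 => if t == s :> nat then a else e.2 t]).
  have tea e0 a : ptail (ea e0 a) = ptail e0.
    by congr (_, _); apply/ffunP=> t; rewrite !ffunE /= ltn_eqF.
  have hea a : phead (ea e a) = phead (ea e' a).
    rewrite /phead /= e1; congr (_, _); apply/ffunP=> t; rewrite !ffunE /=.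
    by case: eqP => // _; have := e2 t; rewrite !ffunE.
  have lts : s.-1 < s by rewrite prednK.
  apply: (mkRel _ _ (fun a => phead (ea e a))).
    move=> a b /(congr1 snd)/= /ffunP/(_ (Ordinal lts)); rewrite !ffunE /=.
    by rewrite /bump /= add1n prednK // eqxx.
  move=> a; split; first by exists (ea e a); left; rewrite tea.
  by exists (ea e' a); left; rewrite tea hea.
move=> e e' te [w1 [w2 [w3 [n12 n13 n23 [c1 c2 c3]]]]].
have adj_succ v w : adjacent v w -> succ_of v w \/ succ_of w v.
  by case=> f [] [-> ->]; [left | right]; apply: succ_of_edge.
have nlev : (phead e).1 <> (ptail e').1.
  have /= e1 := congr1 fst te; rewrite /= e1; apply/eqP; exact: ordS2_neq.
have type w : com (phead e) (ptail e') w ->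
    succ_of (phead e) w /\ succ_of w (ptail e') \/
    succ_of (ptail e') w /\ succ_of w (phead e).
  case=> /adj_succ[] S1 /adj_succ[] S2; [ | by left | by right | ].
    by case: nlev; apply: ordS_inj; case: S1 => <- _; case: S2.
  by case: nlev; case: S1 => -> _; case: S2.
have uniq := succ_of_uniq s2.
move: n12 n13 n23; case: (type w1 c1) => [] [a1 b1]; case: (type w2 c2) => [] [a2 b2];
  case: (type w3 c3) => [] [a3 b3].
all: try by rewrite (uniq _ _ _ _ a1 b1 a2 b2) eqxx.
all: try by rewrite (uniq _ _ _ _ a1 b1 a3 b3) eqxx.
all: by rewrite (uniq _ _ _ _ a2 b2 a3 b3) eqxx.
Qed.

(** * The action on the levels and its kernel *)

Hypothesis outward_rho : forall g, g \in G -> d (g * rho) = ~~ d g.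

Let outward_z g n : g \in G -> d (g * z ^+ n) = d g.
Proof.
move=> Gg; elim: n => [|n IHn]; first by rewrite mulg1.
rewrite expgSr mulgA {1}/(z) expgS expg1 mulgA !outward_rho ?groupM ?groupX //.
by rewrite negbK.
Qed.

Let Fv_out g (j : 'I_s) : d g -> (Fv g).2 j = y g j.
Proof.
move/outward_tail->; rewrite ffunE /y; congr (_ _); apply: val_inj.
by rewrite /= inordK // ltnS ltnW.
Qed.

Let Fv_in g (j : 'I_s) : g \in G -> ~~ d g -> (Fv g).2 j = y g j.+1.
Proof.
move=> Gg /(inward_head Gg) ->; rewrite ffunE /y; congr (_ _); apply: val_inj.
by rewrite /= inordK // ltnS.
Qed.

Let lev_out g : d g -> lev g = (Fe g).1.
Proof. by rewrite /lev => /outward_tail->. Qed.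

Let lev_in g : g \in G -> ~~ d g -> lev g = ordS (Fe g).1.
Proof. by rewrite /lev => Gg /(inward_head Gg) ->. Qed.

Let Fe_ext g g' : (Fe g).1 = (Fe g').1 -> (forall t, t <= s -> y g t = y g' t) ->
  Fe g = Fe g'.
Proof.
move=> e1 e2; rewrite [LHS]surjective_pairing [RHS]surjective_pairing e1.
congr (_, _); apply/ffunP=> t; have := e2 t; rewrite /y inord_val; apply.
by rewrite -ltnS.
Qed.

Let y_tau g t : g \in G -> y (g * tau) t = y g t.
Proof. by move=> Gg; rewrite /y Fe_tau. Qed.

(** Testing the dart 1 is enough: by [levM] and [dM] its elements preserve the level and direction
    of every dart under left multiplication. *)
Definition level_kernel : {set gT} :=
  [set g in G | ((Fv g).1 == (Fv 1).1) && (outward g == outward 1)].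

Local Open Scope ring_scope.
Import GRing.Theory.

Let e g : 'I_r := if d g then 1 else -1.

Let lev_tau g : g \in G -> lev (g * tau)%g = lev g + e g.
Proof.
move=> Gg; rewrite /e; case dg: (d g).
  rewrite lev_in ?groupM // ?outward_tau ?dg // Fe_tau // lev_out //.
  by rewrite -(@add_Zp_1 r).
rewrite lev_out ?outward_tau ?dg // Fe_tau // [lev g]lev_in ?dg //.
by rewrite -(@add_Zp_1 r) addrK.
Qed.

Let dM x w : x \in G -> w \in G -> d (x * w)%g (+) d 1 = d x (+) d w.
Proof.
move=> Gx; move: w; apply: (gen2_ind defG) => [|w Gw IH|w Gw IH].
- by rewrite mulg1.
- by rewrite mulgA !outward_rho ?groupM // addNb addbN IH.
- by rewrite mulgA !outward_tau ?groupM // addNb addbN IH.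
Qed.

(** This is the dihedral action on Z/r: left multiplication by [x] is a rotation or a reflection
    according to the sign [e x * e 1]. *)
Let levM x w : x \in G -> w \in G ->
  lev (x * w)%g = lev x + e x * e 1%g * (lev w - lev 1%g).
Proof.
move=> Gx; move: w; apply: (gen2_ind defG) => [|w Gw IH|w Gw IH].
- by rewrite mulg1 subrr mulr0 addr0.
- by rewrite mulgA /lev -[rho]expg1 !Fv_rho ?groupM // -!/(lev _) IH.
have eM : e (x * w)%g = e x * e 1%g * e w.
  have := dM Gx Gw; rewrite /e; case: (d x); case: (d w); case: (d 1%g);
  by case: (d _) => // _; rewrite ?mul1r ?mulr1 ?mulrN1 ?opprK ?mulN1r ?opprK.
by rewrite mulgA !lev_tau ?groupM // IH eM -addrA -mulrDr addrAC.
Qed.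
Local Close Scope ring_scope.

Let Kr_left g x : g \in level_kernel -> x \in G -> lev (g * x) = lev x /\ d (g * x) = d x.
Proof.
rewrite inE => /and3P[Gg /eqP lg /eqP dg] Gx; split; last first.
  by have := dM Gg Gx; rewrite dg; case: (d _); case: (d x); case: (d 1).
rewrite levM // /e dg {1}/lev lg.
have -> : ((if d 1 then 1 else -1) * (if d 1 then 1 else -1) = 1 :> 'I_r)%R.
  by case: (d 1); rewrite ?mulr1 // mulrNN mulr1.
by rewrite mul1r addrC subrK.
Qed.

Let Kr_group_set : group_set level_kernel.
Proof.
apply/group_setP; split=> [|g g' Kg Kg']; first by rewrite inE group1 !eqxx.
have Gg' : g' \in G by move: Kg'; rewrite inE => /and3P[].
have Gg : g \in G by move: Kg; rewrite inE => /and3P[].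
have [lg dg] := Kr_left Kg Gg'.
move: Kg'; rewrite !inE groupM //= -[(Fv (g * g')).1]/(lev _) lg dg.
by case/andP.
Qed.
Canonical level_kernel_group := Group Kr_group_set.
Local Notation Kr := level_kernel_group.

Let Kr_sub : Kr \subset G.
Proof. by apply/subsetP=> g; rewrite inE => /and3P[]. Qed.

Let Kr_normal : Kr <| G.
Proof.
rewrite /normal Kr_sub; apply/subsetP=> x Gx; rewrite inE; apply/subsetP=> _ /imsetP[g Kg ->].
have Gg := subsetP Kr_sub g Kg.
have [lg dg] := Kr_left Kg Gx.
have := Kg; rewrite inE => /and3P[_ /eqP lg1 /eqP dg1].
have GxV : x^-1 \in G by rewrite groupV.
rewrite inE groupJ //= -![(Fv _).1]/(lev _) conjgE.
have -> : lev 1 = lev (x^-1 * x) by rewrite mulVg.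
have -> : d 1 = d (x^-1 * x) by rewrite mulVg.
have dE : d (x^-1 * (g * x)) = d (x^-1 * x).
  have := dM GxV Gx; have := dM GxV (groupM Gg Gx); rewrite dg.
  by move=> <-; case: (d 1); case: (d _); case: (d _).
by rewrite dE eqxx andbT (levM GxV (groupM Gg Gx)) (levM GxV Gx) lg.
Qed.

Let Kr_z : z \in Kr.
Proof.
have := outward_z 1 (group1 G); rewrite mul1g expg1 => dz.
by have := Fv_rho 2 (group1 G); rewrite inE Gz mul1g => ->; rewrite dz !eqxx.
Qed.

Let Q : {group gT} := <<z ^: G>>%G.

Let Q_normal : Q <| G.
Proof.
rewrite /normal norms_gen ?class_norm // andbT gen_subG; apply/subsetP=> _ /imsetP[x Gx ->].
by rewrite groupJ.
Qed.

Let Q_min (L : {group gT}) : L <| G -> z \in L -> Q \subset L.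
Proof.
move=> nL Lz; rewrite gen_subG; apply/subsetP=> _ /imsetP[x Gx ->].
by rewrite memJ_norm // (subsetP (normal_norm nL)).
Qed.

Let Q_z : z \in Q. Proof. by rewrite mem_gen ?class_refl. Qed.

Let Kr_y g x : g \in Kr -> x \in G -> d x -> (Fe (g * x)).1 = (Fe x).1.
Proof.
by move=> Kg Gx dx; have [lx dgx] := Kr_left Kg Gx; rewrite -!lev_out ?dgx.
Qed.

(** A walk up the levels: [tau] crosses the edge, [rho] turns the arriving dart into an outward one,
    and [z ^+ k] chooses among the [p] outward darts there. *)
Definition fwd (ks : seq nat) : gT := foldr (fun k w => (tau * rho * z ^+ k) * w) 1 ks.

Let Gstep k : tau * rho * z ^+ k \in G. Proof. by rewrite !groupM ?groupX. Qed.

Let Gfwd ks : fwd ks \in G.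
Proof. by elim: ks => [|k ks IH] /=; rewrite ?group1 // groupM. Qed.

Let fwd_rcons ks k : fwd (rcons ks k) = fwd ks * (tau * rho * z ^+ k).
Proof. by elim: ks => [|k' ks IH] /=; rewrite ?mul1g ?mulg1 // IH mulgA. Qed.

Let fwd1 x k : x \in G -> d x -> let x' := x * (tau * rho * z ^+ k) in
  [/\ d x', (Fe x').1 = ordS (Fe x).1 & forall t, t < s -> y x' t = y x t.+1].
Proof.
move=> Gx dx x'; have Gxt : x * tau \in G by rewrite groupM.
have ex' : x' = x * tau * rho ^+ (2 * k)%N.+1 by rewrite /x' -expgM expgS !mulgA.
have Gx' : x' \in G by rewrite groupM.
have dx' : d x'.
  by rewrite /x' !mulgA outward_z ?groupM // outward_rho ?groupM // outward_tau ?dx.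
have evx : Fv x' = Fv (x * tau) by rewrite ex' Fv_rho.
have dxt : ~~ d (x * tau) by rewrite outward_tau ?dx.
split=> // [|t lt_t]; first by rewrite -lev_out // /lev evx -/(lev _) lev_in // Fe_tau.
by rewrite -[t]/(val (Ordinal lt_t)) -Fv_out // evx Fv_in // y_tau.
Qed.

Let fwdP ks x : x \in G -> d x ->
  [/\ d (x * fwd ks), (Fe (x * fwd ks)).1 = iter (size ks) (@ordS r) (Fe x).1 &
      forall t, t + size ks <= s -> y (x * fwd ks) t = y x (t + size ks)].
Proof.
elim/last_ind: ks => [|ks k IH] Gx dx; first by split=> [||t]; rewrite mulg1 ?addn0.
have [dk lk yk] := IH Gx dx; have Gxk : x * fwd ks \in G by rewrite groupM.
have [dk' lk' yk'] := fwd1 k Gxk dk.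
rewrite fwd_rcons mulgA size_rcons; split=> [//||t le_t]; first by rewrite lk' lk.
rewrite yk'; last by apply: leq_trans le_t; rewrite addnS ltnS leq_addr.
by rewrite yk addSnnS.
Qed.

Let order_z : #[z] = p.
Proof. by rewrite orderXdiv order_rho ?dvdn_mulr // mulKn. Qed.

Let z_onto x b : x \in G -> d x -> exists k, y (x * z ^+ k) s = b.
Proof.
move=> Gx dx; pose f (k : 'I_p) := y (x * z ^+ k) s.
have f_inj : injective f.
  move=> k k' efk; have Gk n : x * z ^+ n \in G by rewrite groupM ?groupX.
  have dk n : d (x * z ^+ n) by rewrite outward_z.
  have Fvk n : Fv (x * z ^+ n) = Fv x by rewrite -expgM Fv_rho.
  have: x * z ^+ k = x * z ^+ k'.
    apply: dart_inj; rewrite ?dk // ?Gk //; apply: Fe_ext => [|t].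
      by rewrite -!lev_out // /lev !Fvk.
    rewrite leq_eqVlt => /predU1P[->//|lt_t].
    by rewrite -[t]/(val (Ordinal lt_t)) -!Fv_out // !Fvk.
  move/mulgI/eqP; rewrite eq_expg_mod_order order_z !modn_small //.
  by move/eqP/val_inj.
have [g _ gK] := injF_bij f_inj; by exists (g b); apply: gK.
Qed.

(** Each step moves the coordinates down one place and leaves the new last one free, by [z_onto];
    after [n] steps the [m]-th choice sits at position [s + m - n]. *)
Let fwd_onto x (f : nat -> 'I_p) n : x \in G -> d x -> n <= s.+1 ->
  exists2 ks, size ks = n & forall m, 0 < m <= n -> y (x * fwd ks) (s + m - n) = f m.
Proof.
move=> Gx dx; elim: n => [|n IHn] le_n.
  by exists [::] => // m /andP[m_gt0]; rewrite leqNgt m_gt0.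
have [ks szk yk] := IHn (ltnW le_n).
have [dk _ _] := fwdP ks Gx dx; have Gxk : x * fwd ks \in G by rewrite groupM.
have [d0 l0 y0] := fwd1 0 Gxk dk.
have Gx0 : x * fwd ks * (tau * rho * z ^+ 0) \in G by rewrite groupM.
have [k yks] := z_onto (f n.+1) Gx0 d0.
have [_ _ y1] := fwd1 k Gxk dk.
exists (rcons ks k); first by rewrite size_rcons szk.
move=> m /andP[m_gt0]; rewrite leq_eqVlt fwd_rcons mulgA => /predU1P[->|lt_m].
  by rewrite addnK -yks expg0 mulg1 !mulgA.
have e1 : (s + m - n.+1).+1 = (s + m - n)%N.
  rewrite subnS prednK // subn_gt0; apply: leq_ltn_trans (_ : s < _) => //.
  by rewrite -addn1 leq_add2l.
rewrite y1; first by rewrite e1 yk // m_gt0.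
by rewrite e1 leq_subLR addnC leq_add2r.
Qed.

Let fwd_Q ks : fwd ks * (tau * rho) ^- size ks \in Q.
Proof.
elim: ks => [|k ks IH] /=; first by rewrite invg1 mulg1.
have nQ u : u \in G -> u \in 'N(Q) by apply/subsetP/normal_norm.
set a := tau * rho in IH *; have Ga : a \in G by rewrite groupM.
have -> : a * z ^+ k * fwd ks * a ^- (size ks).+1 =
    (z ^+ k * (fwd ks * a ^- size ks)) ^ a^-1.
  by rewrite conjgE invgK [a ^+ _.+1]expgS invMg !mulgA.
by rewrite memJ_norm ?nQ ?groupV // groupM // groupX.
Qed.

(** Walks of length [s.+1] from [x] reach every coordinate tuple, and each differs from the straight
    walk [(tau * rho) ^+ s.+1] by an element of [Q]. Conjugation by [x^-1] turns this difference
    into a left multiplication. *)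
Let Q_large : p ^ s.+1 <= #|Q|.
Proof.
have [x [Gx _ dx]] := dart_onto (Fe 1) true.
pose f q : {ffun 'I_s.+1 -> 'I_p} := (Fe (q * (x * (tau * rho) ^+ s.+1))).2.
have -> : (p ^ s.+1)%N = #|[set: {ffun 'I_s.+1 -> 'I_p}]|.
  by rewrite cardsT card_ffun !card_ord.
apply: leq_trans (leq_imset_card f Q); apply: subset_leq_card.
apply/subsetP=> v _.
have [ks szk yk] := fwd_onto (fun m => v (inord m.-1)) Gx dx (leqnn s.+1).
pose q := fwd ks * (tau * rho) ^- s.+1.
have Qq : q \in Q by rewrite /q -szk fwd_Q.
have Qx : q ^ x^-1 \in Q by rewrite memJ_norm // (subsetP (normal_norm Q_normal)) ?groupV.
apply/imsetP; exists (q ^ x^-1) => //.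
rewrite /f; have -> : q ^ x^-1 * (x * (tau * rho) ^+ s.+1) = x * fwd ks.
  by rewrite conjgE invgK -!mulgA mulKg mulVg mulg1.
apply/ffunP=> t; have := yk t.+1; rewrite /= ltn_ord => /(_ isT).
by rewrite addnS -addSn addnC addnK /y !inord_val => ->.
Qed.

Let Kr_small : #|Kr| <= p ^ s.+1.
Proof.
pose f g : {ffun 'I_s.+1 -> 'I_p} := (Fe g).2.
have f_inj : {in Kr &, injective f}.
  move=> g g'; rewrite !inE => /and3P[Gg /eqP lg /eqP dg] /and3P[Gg' /eqP lg' /eqP dg'] efg.
  apply: dart_inj; rewrite ?dg //.
  rewrite [LHS]surjective_pairing [RHS]surjective_pairing -/(f g) efg; congr (_, _).
  case d1: (d 1); first by rewrite -!lev_out ?dg ?dg' // /lev lg lg'.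
  by apply: ordS_inj; rewrite -!lev_in ?dg ?dg' ?d1 // /lev lg lg'.
rewrite -(card_in_imset f_inj); apply: leq_trans (max_card _) _.
by rewrite card_ffun !card_ord.
Qed.

Let Q_Kr : Q :=: Kr.
Proof.
apply/eqP; rewrite eqEcard Q_min //=.
exact: leq_trans Kr_small Q_large.
Qed.

Let card_Kr : #|Kr| = (p ^ s.+1)%N.
Proof. by apply/eqP; rewrite eqn_leq Kr_small -Q_Kr Q_large. Qed.

Let Kr_pgroup : p.-group Kr.
Proof. by rewrite /pgroup card_Kr pnatX pnat_id. Qed.

(* The first coordinate of [g * u] only depends on the level and the first
   coordinate of [u]: u is reached from any v that has this value as its last
   coordinate, s levels below. *)
Let coord0_Kr g u u' : g \in Kr -> u \in G -> u' \in G -> d u -> d u' ->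
  (Fe u).1 = (Fe u').1 -> y u 0 = y u' 0 -> y (g * u) 0 = y (g * u') 0.
Proof.
move=> Kg Gu Gu' du du' lu yu.
have iterK n (i : 'I_r) : iter n (@ordS r) (iter n (@ord_pred r) i) = i.
  by elim: n => //= n IH; rewrite -iterS iterSr ord_predK.
have [v [Gv ev dv]] := dart_onto (iter s (@ord_pred r) (Fe u).1, [ffun=> y u 0]) true.
have Gg := subsetP Kr_sub g Kg; have [_ dgv] := Kr_left Kg Gv.
have key u2 : u2 \in G -> d u2 -> (Fe u2).1 = (Fe u).1 -> y u2 0 = y u 0 ->
    y (g * u2) 0 = y (g * v) s.
  move=> Gu2 du2 lu2 yu2.
  have [ks szk yk] := fwd_onto (y u2) Gv dv (leqnSn s).
  have [dk lk yk0] := fwdP ks Gv dv.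
  have -> : u2 = v * fwd ks.
    apply: dart_inj; rewrite ?groupM // ?dk //; apply: Fe_ext => [|[|t] le_t].
    - by rewrite lk szk ev /= lu2 iterK.
    - by rewrite yk0 szk // add0n yu2 /y ev ffunE.
    by rewrite -(yk t.+1) // addnC addnK.
  have dgv1 : d (g * v) by rewrite dgv.
  by rewrite mulgA; have [_ _ ->] := fwdP ks (groupM Gg Gv) dgv1; rewrite szk.
by rewrite (key u) // (key u').
Qed.

(** By [coord0_Kr], fixing the first coordinate at [u] defines a subgroup of [Kr] of index at most
    [p], so either [Kr] or a maximal subgroup; both contain the Frattini subgroup. After [t] steps
    of a walk the [t]-th coordinate has become the first, so Frattini elements fix whole darts. *)
Let Phi_Kr : 'Phi(Kr) = 1.
Proof.
have coord0 g u : g \in 'Phi(Kr) -> u \in G -> d u -> y (g * u) 0 = y u 0.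
  move=> Pg Gu du.
  pose S := [set x in Kr | y (x * u) 0 == y u 0].
  have gS : group_set S.
    apply/group_setP; split=> [|a b]; first by apply/setIdP; rewrite mul1g.
    case/setIdP=> Ka /eqP ya /setIdP[Kb /eqP yb].
    apply/setIdP; split; first exact: groupM.
    rewrite -mulgA.
    have Gb := subsetP Kr_sub b Kb.
    have [_ db] := Kr_left Kb Gu.
    rewrite (@coord0_Kr a (b * u) u) ?groupM ?db // ?ya //.
    by rewrite Kr_y.
  pose Sg := Group gS.
  have sSK : Sg \subset Kr by apply/subsetP=> x /setIdP[].
  have iS : #|Kr : Sg| <= p.
    have f_inj : {in lcosets Sg Kr &, injective (fun A => y (repr A * u) 0)}.
      have reprP A : A \in lcosets Sg Kr -> repr A \in Kr /\ A = repr A *: Sg.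
        case/imsetP=> x Kx ->; rewrite lcosetE.
        have xr : repr (x *: Sg) \in x *: Sg by apply: (mem_repr x (lcoset_refl _ _)).
        split; last by apply/lcoset_eqP; rewrite lcoset_sym.
        by case/lcosetP: xr => w Sw ->; rewrite groupM // (subsetP sSK).
      move=> A B /reprP[KA eA] /reprP[KB eB] eyAB.
      rewrite eA eB; apply/eqP; rewrite lcoset_eqE.
      have KAV : (repr A)^-1 \in Kr by rewrite groupV.
      apply/setIdP; split; first exact: groupM.
      rewrite -mulgA.
      have [GA GB] := (subsetP Kr_sub _ KA, subsetP Kr_sub _ KB).
      have [[_ dA] [_ dB]] := (Kr_left KA Gu, Kr_left KB Gu).
      rewrite (@coord0_Kr _ _ (repr A * u)) ?groupM ?dA ?dB //.
        by rewrite mulKg.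
      by rewrite !Kr_y.
    rewrite -card_lcosets -(card_in_imset f_inj); apply: leq_trans (max_card _) _.
    by rewrite card_ord.
  suff: g \in Sg by case/setIdP=> _ /eqP.
  have /p_natP[n en] := pnat_dvd (dvdn_indexg Kr Sg) Kr_pgroup.
  move: iS; rewrite en -{2}[p]expn1 leq_exp2l ?prime_gt1 //.
  case: n en => [|[|//]] en _.
    have -> : Sg = Kr by apply/val_inj/eqP; rewrite eqEsubset sSK -indexg_eq1 en.
    exact: (subsetP (Phi_sub _)).
  apply: (subsetP (Phi_sub_max _)) Pg; apply: p_index_maximal => //.
  by rewrite en expn1.
apply/trivgP/subsetP=> g Pg; apply/set1gP.
have Kg : g \in Kr by apply: (subsetP (Phi_sub _)).
have [u [Gu _ du]] := dart_onto (Fe 1) true.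
have Gg := subsetP Kr_sub g Kg; have [_ dgu] := Kr_left Kg Gu.
apply: (mulIg u); rewrite mul1g; apply: dart_inj; rewrite ?groupM //.
apply: Fe_ext => [|t le_t]; first exact: Kr_y.
have := fwdP (nseq t 0) Gu du; have := fwdP (nseq t 0) (groupM Gg Gu).
rewrite dgu size_nseq => /(_ du)[_ _ y1] [d2 _ y2].
by rewrite -[t]add0n -y1 // -y2 // -mulgA; apply: coord0; rewrite ?groupM.
Qed.

Theorem PX_good : good p r G Kr rho tau.
Proof.
split=> //; last by move=> L nL Lz; rewrite -Q_Kr Q_min.
split=> //; first by rewrite -trivg_Phi ?Phi_Kr.
by rewrite card_Kr cardG.
Qed.

End PXgroup.

(** * The exceptional graphs and the theorem *)

Section K2p2p.
Variable p : nat.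
Hypotheses (pr_p : prime p) (odd_p : odd p).
Variables (gT : finGroupType) (G : {group gT}) (rho tau : gT).
Hypotheses (defG : G :=: <<[set rho; tau]>>) (order_tau : #[tau] = 2).
Hypotheses (order_rho : #[rho] = (2 * p)%N) (cardG : #|G| = (8 * p ^ 2)%N).
Variable par : gT -> bool.
Hypothesis par_rho : forall g, g \in G -> par (g * rho) = par g.
Hypothesis par_tau : forall g, g \in G -> par (g * tau) = ~~ par g.
Local Notation z := (rho ^+ 2).
Hypothesis tiz : <[z]> :&: <[z ^ tau]> = 1.

Let Grho : rho \in G. Proof. by rewrite defG mem_gen // !inE eqxx. Qed.
Let Gtau : tau \in G. Proof. by rewrite defG mem_gen // !inE eqxx orbT. Qed.
Let Gz : z \in G. Proof. exact: groupX. Qed.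
Let tau2 : tau * tau = 1.
Proof. by rewrite -[tau * tau]/(tau ^+ 2) -order_tau expg_order. Qed.

Let parM x w : x \in G -> w \in G -> par (x * w) (+) par 1 = par x (+) par w.
Proof.
move=> Gx; move: w; apply: (gen2_ind defG) => [|w Gw IH|w Gw IH].
- by rewrite mulg1.
- by rewrite mulgA !par_rho ?groupM.
- by rewrite mulgA !par_tau ?groupM // addNb addbN IH.
Qed.

Definition even_part := [set g in G | par g == par 1].
Let even_group_set : group_set even_part.
Proof.
apply/group_setP; split=> [|x w]; first by rewrite inE group1 eqxx.
rewrite !inE => /andP[Gx /eqP px] /andP[Gw /eqP pw]; rewrite groupM //=.
by have := parM Gx Gw; rewrite px pw; case: (par _); case: (par 1).
Qed.
Canonical even_part_group := Group even_group_set.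
Local Notation H := even_part_group.

Let sHG : H \subset G. Proof. by apply/subsetP=> x /setIdP[]. Qed.

Let indexH : #|G : H| = 2.
Proof.
have eD : G :\: H = H :* tau.
  apply/setP=> x; rewrite mem_rcoset !inE; have tV : tau^-1 = tau.
    by apply: (mulgI tau); rewrite mulgV tau2.
  rewrite tV; case Gx: (x \in G) => /=; last first.
    apply/esym/negP=> /andP[Gxt _].
    by move: Gx; rewrite -(mulgK tau x) groupMr ?groupV // Gxt.
  by rewrite groupM // par_tau // andbT; case: (par x); case: (par 1).
have := cardsID H G; rewrite (setIidPr sHG) eD card_rcoset addnn -muln2 => cG.
by rewrite -divgS // -cG mulKn.
Qed.

Let cardH : #|H| = (4 * p ^ 2)%N.
Proof.
apply/eqP; rewrite -(@eqn_pmul2r 2) //; apply/eqP.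
by rewrite -{1}indexH Lagrange // cardG mulnAC.
Qed.

Let nHG : H <| G. Proof. exact: index2_normal. Qed.

Let Hrho : rho \in H.
Proof. by apply/setIdP; split=> //; rewrite -[rho]mul1g par_rho. Qed.
Let Hz : z \in H. Proof. exact: groupX. Qed.

Let order_z : #[z] = p.
Proof. by rewrite orderXdiv order_rho ?dvdn_mulr // mulKn. Qed.

Let p_gt0 := prime_gt0 pr_p.
Let partH : (#|H|`_p)%N = (p ^ 2)%N.
Proof.
rewrite cardH partnM ?expn_gt0 ?p_gt0 // (@part_pnat_id _ (p ^ 2)) ?pnatX ?pnat_id //.
by rewrite part_p'nat ?mul1n // p'natE // -prime_coprime // -[4]/(2 ^ 2)%N coprimeXr // coprimen2.
Qed.

(** The centraliser contains [rho], of order [2 * p], and a Sylow subgroup through [z], abelian as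
    its order is p^2; so its order is divisible by 2p^2, while [H] has order 4p^2. *)
Let z_index : #|H : 'C_H[z]| %| 2.
Proof.
have sz : <[z]> \subset H by rewrite cycle_subG.
have pz : p.-group <[z]> by rewrite /pgroup -[#|_|]/(#[_]) order_z pnat_id.
have [S sylS sSz] := Sylow_superset sz pz.
have cardS := card_Hall sylS; rewrite partH in cardS.
have abS : abelian S by apply: (@p2group_abelian _ p); rewrite ?(pHall_pgroup sylS) // cardS pfactorK.
have sSC : S \subset 'C_H[z].
  rewrite subsetI (pHall_sub sylS) sub_cent1 (subsetP abS) // (subsetP sSz) ?cycle_id //.
have srC : <[rho]> \subset 'C_H[z].
  by rewrite subsetI !cycle_subG Hrho; apply/cent1P; apply: commuteX.
have d2 : 2 %| #|'C_H[z]| by rewrite (dvdn_trans _ (cardSg srC)) // -[#|_|]/(#[_]) order_rho dvdn_mulr.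
have dp : p ^ 2 %| #|'C_H[z]| by rewrite -cardS cardSg.
have : 2 * p ^ 2 %| #|'C_H[z]|.
  by rewrite Gauss_dvd ?d2 // coprimeXr // coprime2n odd_p.
case/dvdnP=> m em; have := Lagrange (subsetIl H 'C[z]); rewrite em cardH.
have -> : (4 * p ^ 2 = 2 * (2 * p ^ 2))%N by rewrite mulnA.
rewrite mulnAC => /eqP; rewrite eqn_pmul2r ?muln_gt0 ?expn_gt0 ?p_gt0 // => /eqP e2.
by apply/dvdnP; exists m.
Qed.

Let p_elt_cent x : x \in H -> p.-elt x -> commute x z.
Proof.
move=> Hx px.
have nC : 'C_H[z] <| H.
  have [i1|i2] : #|H : 'C_H[z]| = 1%N \/ #|H : 'C_H[z]| = 2.
    by case: #|_ : _| z_index (indexg_gt0 H 'C_H[z]) => [|[|[|n]]] // _; [left | right].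
  - by move/eqP: i1; rewrite indexg_eq1 => s; rewrite /normal subsetIl (subset_trans s) ?normG.
  by apply: index2_normal; rewrite ?subsetIl.
have nx : x \in 'N('C_H[z]) by apply: (subsetP (normal_norm nC)).
have x2 : x ^+ 2 \in 'C_H[z].
  apply: coset_idr; first exact: groupX.
  apply/eqP; rewrite morphX // -order_dvdn; apply: dvdn_trans z_index.
  rewrite -card_quotient ?normal_norm // order_dvdG // mem_quotient //.
have ox : odd #[x].
  by have [n ->] := p_natP px; rewrite oddX odd_p orbT.
have : x \in 'C_H[z].
  (* Squares lie in the centraliser, which has index at most 2, and an element of odd order is a
     power of its square. *)
  have -> : x = (x ^+ 2) ^+ (#[x].+1)./2.
    rewrite -expgM mul2n; have := odd_double_half #[x].+1; rewrite /= ox add0n => ->.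
    by rewrite expgS expg_order mulg1.
  exact: groupX.
by case/setIP=> _ /cent1P.
Qed.

Let z' := z ^ tau.
Let tau_H x : x \in H -> x ^ tau \in H.
Proof. by move=> Hx; rewrite memJ_norm // (subsetP (normal_norm nHG)). Qed.
Let conjtt x : (x ^ tau) ^ tau = x. Proof. by rewrite -conjgM tau2 conjg1. Qed.

Let p_elt_cent' x : x \in H -> p.-elt x -> commute x z'.
Proof.
move=> Hx px; have := p_elt_cent (tau_H Hx); rewrite p_eltJ => /(_ px) c.
by rewrite /commute -[x]conjtt /z' -!conjMg c.
Qed.

Let pz : p.-elt z. Proof. by rewrite /p_elt order_z pnat_id. Qed.
Let pz' : p.-elt z'. Proof. by rewrite p_eltJ. Qed.
Let Hz' : z' \in H. Proof. exact: tau_H. Qed.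

Let P : {group gT} := (<[z]> <*> <[z']>)%G.

Let defP : <[z]> \x <[z']> = P.
Proof.
apply: dprodEY => //.
by rewrite cent_cycle cycle_subG; apply/cent1P; apply: p_elt_cent.
Qed.

Let cardP : #|P| = (p ^ 2)%N.
Proof. by rewrite -(dprod_card defP) -![#|<[_]>|]/(#[_]) orderJ order_z. Qed.

Let abP : p.-abelem P.
Proof.
rewrite (dprod_abelem p defP) !prime_abelem //.
  by rewrite -[#|_|]/(#[_]) orderJ order_z.
Qed.

Let sPH : P \subset H. Proof. by rewrite join_subG !cycle_subG Hz. Qed.

Let P_pelt x : x \in H -> p.-elt x -> x \in P.
Proof.
move=> Hx px; have sylP : p.-Sylow(H) P by rewrite pHallE sPH cardP partH eqxx.
have cPx : <[x]> \subset 'C(P).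
  rewrite centsC cent_cycle join_subG !cycle_subG.
  by apply/andP; split; apply/cent1P; [apply/commute_sym/p_elt_cent | apply/commute_sym/p_elt_cent'].
have pPx : p.-group (P <*> <[x]>).
  by rewrite cent_joinEr // pgroupM (abelem_pgroup abP) -/(p.-elt x).
have sPx : P <*> <[x]> \subset H by rewrite join_subG sPH cycle_subG.
have <- := sub_pHall sylP pPx (joing_subl _ _) sPx.
by rewrite -cycle_subG joing_subr.
Qed.

Let nPG : P <| G.
Proof.
rewrite /normal (subset_trans sPH sHG) {1}defG gen_subG subUset !sub1set /=.
have pJ g x : g \in G -> x \in P -> x ^ g \in P.
  move=> Gg Px; apply: P_pelt.
    by rewrite memJ_norm ?(subsetP sPH) // (subsetP (normal_norm nHG)).
  by rewrite p_eltJ (mem_p_elt (abelem_pgroup abP)).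
by rewrite !inE; apply/andP; split; apply/subsetP=> _ /imsetP[x Px ->]; apply: pJ.
Qed.

Lemma K2p2p_good : good p 4 G P rho tau.
Proof.
split=> //.
  split=> //; first by rewrite cardP cardG.
  by apply: P_pelt.
move=> L nL Lz; rewrite join_subG !cycle_subG Lz /=.
by rewrite memJ_norm // (subsetP (normal_norm nL)).
Qed.

End K2p2p.

Lemma PX_graph_good (p r s : nat) (gT : finGroupType) (G : {group gT}) (rho tau : gT) :
  prime p -> odd p -> 3 <= r -> is_rotary (RData G rho tau) ->
  rota_graph_iso (RData G rho tau) (@PXinc p r s) ->
  exists P : {group gT}, good p r G P rho tau.
Proof.
move=> pr_p odd_p r_ge3 rotD isoD; have p_gt0 := prime_gt0 pr_p.
have p_ge3 : 3 <= p by apply: odd_prime_gt2.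
have cV : #|{: PXV p r s}| = (r * p ^ s)%N by rewrite card_prod card_ffun !card_ord.
have cE : #|{: PXE p r s}| = (r * p ^ s.+1)%N by rewrite card_prod card_ffun !card_ord.
have ps_gt0 : 0 < p ^ s by rewrite expn_gt0 p_gt0.
have V_gt1 : 1 < #|{: PXV p r s}|.
  by rewrite cV; apply: leq_trans (leq_pmulr r ps_gt0); apply: leq_trans r_ge3.
have [Fv [Fe [[FvE FeE Fv_onto Fe_onto ends] [c1 c2 ntau]]]] :=
  rota_graph_isoE (@PXincE p r s) rotD isoD V_gt1.
rewrite /= cV cE in FvE FeE Fv_onto Fe_onto ends c1 c2 ntau.
have [/= defG order_tau] := rotD.
(* There are [p] times as many edges as vertices, and [#|G|] is both [#|V| * #[rho]] and
   [#|E| * 2]. *)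
have order_rho : #[rho] = (2 * p)%N.
  apply/eqP; rewrite -(@eqn_pmul2l (r * p ^ s)%N) ?muln_gt0 ?ps_gt0 ?(leq_trans _ r_ge3) //.
  by rewrite -c1 c2 expnSr -!mulnA [(p * 2)%N]mulnC.
have cardG : #|G| = (2 * r * p ^ s.+1)%N by rewrite c2 mulnC mulnA.
case: r r_ge3 rotD isoD cV cE V_gt1 c1 c2 Fv Fe FvE FeE Fv_onto Fe_onto ends cardG => [|[|r0]] // r_ge3.
move=> rotD isoD cV cE V_gt1 c1 c2 Fv Fe FvE FeE Fv_onto Fe_onto ends cardG.
have of_split : (forall g, g \in G -> outward Fv Fe (g * rho) = ~~ outward Fv Fe g) ->
    exists P : {group gT}, good p r0.+2 G P rho tau.
  move=> spl; have gG := PX_good pr_p defG order_tau FvE FeE Fe_onto ends order_rho cardG spl.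
  by eexists; apply: gG.
have [s0|s_gt0] := posnP s.
  by apply: of_split; apply: (outward_rho_s0 r_ge3 defG FvE FeE Fe_onto ends s0).
have [s1|s_ge2] := leqP s 1; last first.
  by apply: of_split; apply: (outward_rho_s2 r_ge3 defG FvE FeE Fv_onto Fe_onto ends s_ge2).
have {s_gt0}s1 : s = 1%N by apply/eqP; rewrite eqn_leq s1.
have [r4|r4] := eqVneq r0.+2 4; last first.
  by apply: of_split; apply: (outward_rho_s1 r_ge3 defG FvE FeE Fv_onto Fe_onto ends s1 r4).
subst s; case: r4 => er0; subst r0; exists (<[rho ^+ 2]> <*> <[rho ^+ 2 ^ tau]>)%G.
have Grho : rho \in G by rewrite defG mem_gen // !inE eqxx.
have Gtau : tau \in G by rewrite defG mem_gen // !inE eqxx orbT.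
have oddS (i : 'I_4) : odd (ordS i) = ~~ odd i by rewrite /= odd_mod.
apply: (@K2p2p_good p pr_p odd_p gT G rho tau defG order_tau order_rho _ (fun g => odd (Fv g).1)).
- by rewrite cardG.
- move=> g Gg; suff -> : Fv (g * rho) = Fv g by [].
  by apply/esym/eqP; rewrite FvE // ?mulKg ?cycle_id // groupM.
- move=> g Gg; case: (ends g Gg) => [] [-> ->]; rewrite /ptail /phead /=.
    exact: oddS.
  by rewrite oddS negbK.
have edge_inj (e e' : PXE p 4 1) : ptail e = ptail e' -> phead e = phead e' -> e = e'.
  move=> te he; rewrite [LHS]surjective_pairing [RHS]surjective_pairing.
  rewrite (congr1 fst te : e.1 = e'.1); congr (_, _); apply/ffunP=> t.
  case: (unliftP ord0 t) => [j|] ->.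
    by have /ffunP/(_ j) := congr1 snd he; rewrite !ffunE.
  have /ffunP/(_ ord0) := congr1 snd te; rewrite !ffunE.
  by have -> : widen_ord (leqnSn 1) ord0 = ord0 by apply: val_inj.
(* An element of both cyclic groups fixes both ends of the edge of the dart 1. For [s = 1] an edge
   is determined by its ends, so [a] fixes this edge and is 1 or [tau]; but [tau] is not in
   [<[rho]>]. *)
apply/trivgP/subsetP=> a /setIP[za za']; apply/set1gP.
have ra : a \in <[rho]> by apply: subsetP za; rewrite cycle_subG mem_cycle.
have rat : a ^ tau^-1 \in <[rho]>.
  have: a \in <[rho ^+ 2]> :^ tau by rewrite -cycleJ.
  by rewrite mem_conjg; apply: subsetP; rewrite cycle_subG mem_cycle.
have tV : tau^-1 = tau by apply: (mulgI tau); rewrite mulgV -[tau * tau]/(tau ^+ 2) -order_tau expg_order.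
have Ga : a \in G by apply: subsetP ra; rewrite cycle_subG.
have eFa : Fv 1 = Fv a by apply/eqP; rewrite FvE // invg1 mul1g.
have eFat : Fv (1 * tau) = Fv (a * tau).
  by apply/eqP; rewrite mul1g FvE ?(groupM Ga) // -conjgE; rewrite tV in rat.
have eFe : Fe 1 = Fe a.
  have lev2 (e e' : PXE p 4 1) : ptail e = phead e' -> phead e = ptail e' -> False.
    move=> te he; have /= e1 := congr1 fst te; have /= := congr1 fst he; rewrite e1.
    by case: (e'.1) => -[|[|[|[|m]]]] // lm /(congr1 val).
  move: eFa eFat; case: (ends 1 (group1 G)) => [] [-> ->]; case: (ends a Ga) => [] [-> ->] te he.
  - exact: edge_inj.
  - by case: (lev2 _ _ te he).
  - by case: (lev2 _ _ he te).
  - exact: edge_inj.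
move/eqP: eFe; rewrite FeE // invg1 mul1g (cycle2g order_tau) !inE => /orP[]/eqP // ea.
by move: ntau; rewrite -ea ra.
Qed.

(** A transport between types along the isomorphism of [G] with [G / L]. For the cycle, where [P]
    has prime order, the only proper [L] is trivial. *)
Lemma rota_graph_iso_trivial_quotient (gT : finGroupType) (G L : {group gT}) (rho tau : gT)
    (V E : finType) (tl hd : E -> V) (inc : V -> E -> bool) :
  (forall v e, inc v e = (v == tl e) || (v == hd e)) -> 1 < #|V| -> L :=: 1 -> L <| G ->
  is_rotary (RData G rho tau) -> is_rotary (qdata G rho tau L) ->
  rota_graph_iso (RData G rho tau) inc -> rota_graph_iso (qdata G rho tau L) inc.
Proof.
move=> incE V_gt1 L1 nL rotD rotQ isoD.
have [Fv [Fe [[/= FvE FeE _ _ ends] [/= c1 c2 _]]]] := rota_graph_isoE incE rotD isoD V_gt1.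
have [[/= defG order_tau] [/= defQ order_tauQ]] := (rotD, rotQ).
have Grho : rho \in G by rewrite defG mem_gen // !inE eqxx.
have Gtau : tau \in G by rewrite defG mem_gen // !inE eqxx orbT.
have nLx x : x \in G -> x \in 'N(L) by apply/subsetP/normal_norm.
have reprK x : x \in G -> repr (coset L x) = x.
  move=> Gx; rewrite val_coset ?nLx // L1.
  have := mem_repr x (rcoset_refl 1%G x).
  by case/rcosetP=> u /set1gP-> ->; rewrite mul1g.
have coset_inj x w : x \in G -> w \in G -> coset L x = coset L w -> x = w.
  by move=> Gx Gw e; rewrite -(reprK x) // e reprK.
have cosetP X : X \in (G / L)%G -> exists2 x, x \in G & X = coset L x.
  by case/morphimP=> x _ Gx ->; exists x.
have memC x w : x \in G -> w \in G -> (coset L x \in <[coset L w]>) = (x \in <[w]>).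
  move=> Gx Gw; apply/cycleP/cycleP => -[n]; last by move=> ->; exists n; rewrite morphX ?nLx.
  by rewrite -morphX ?nLx // => /coset_inj e; exists n; apply: e; rewrite ?groupX.
have cVM x w : x \in G -> w \in G -> (coset L x)^-1 * coset L w = coset L (x^-1 * w).
  by move=> Gx Gw; rewrite morphM ?morphV ?nLx ?groupV.
have cardQ : #|G / L| = #|G| by rewrite card_quotient ?normal_norm // L1 indexg1.
have oC x : x \in G -> #[coset L x] = #[x].
  move=> Gx; apply/eqP; rewrite eqn_dvd !order_dvdn -morphX ?nLx // expg_order morph1 eqxx /=.
  apply/eqP; apply: coset_inj; rewrite ?groupX ?group1 // morph1 morphX ?nLx //.
  by rewrite expg_order.
apply: (@rota_graph_isoI (qdata G rho tau L) _ _ tl hd _ incE rotQ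
  (fun X => Fv (repr X)) (fun X => Fe (repr X))) => /=.
- by move=> _ _ /cosetP[x Gx ->] /cosetP[w Gw ->]; rewrite !reprK // FvE // cVM // memC // groupM ?groupV.
- by move=> _ _ /cosetP[x Gx ->] /cosetP[w Gw ->]; rewrite !reprK // FeE // cVM // memC // groupM ?groupV.
- rewrite -divgS ?cycle_subG ?mem_quotient // cardQ -[#|<[_]>|]/(#[_]) oC // c1 mulnK //.
- rewrite -divgS ?cycle_subG ?mem_quotient // cardQ -[#|<[_]>|]/(#[_]) oC // c2 order_tau mulnK //.
move=> _ /cosetP[x Gx ->] /=.
have rt : repr (coset L x * coset L tau) = x * tau.
  by rewrite -[RHS]reprK ?groupM // morphM ?nLx.
rewrite reprK //; have := ends x Gx; rewrite -rt; exact.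
Qed.

(** * The cycle of length [p * r] *)

Section Cycle.
Variables (p r : nat).
Hypotheses (pr_p : prime p) (odd_p : odd p) (r_ge3 : 3 <= r).
Variables (gT : finGroupType) (G : {group gT}) (rho tau : gT).
Hypothesis rotD : is_rotary (RData G rho tau).
Hypothesis isoD : rota_graph_iso (RData G rho tau) (@Cinc (p * r)).

Let V_gt1 : 1 < #|'I_(p * r)|.
Proof.
rewrite card_ord; apply: leq_trans (leq_pmulr p _); first exact: prime_gt1.
exact: leq_trans r_ge3.
Qed.

(** Counting makes [rho] an involution, so [G] is dihedral with rotation [c = rho * tau]. The index
    of [<[c]>] is at most 2 and [p] is odd, so [p] divides [#[c]]; [P] is the subgroup of order [p]
    of [<[c]>]. *)
Lemma cycle_core : exists P : {group gT}, core p r G P rho tau /\ #|P| = p.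
Proof.
have [Fv [Fe [_ [/= c1 c2 ntau]]]] :=
  rota_graph_isoE (tl := id) (hd := @ordS (p * r)) (fun v e => erefl) rotD isoD V_gt1.
have [/= defG order_tau] := rotD.
have Grho : rho \in G by rewrite defG mem_gen // !inE eqxx.
have Gtau : tau \in G by rewrite defG mem_gen // !inE eqxx orbT.
rewrite card_ord in c1 c2.
have p_gt0 := prime_gt0 pr_p.
have r_gt0 : 0 < r by apply: leq_trans r_ge3.
have order_rho : #[rho] = 2.
  by apply/eqP; rewrite -(@eqn_pmul2l (p * r)%N) ?muln_gt0 ?p_gt0 // -c1 c2.
have sq (x : gT) : #[x] = 2 -> x * x = 1 by move=> e; rewrite -[x * x]/(x ^+ 2) -e expg_order.
have sqV (x : gT) : #[x] = 2 -> x^-1 = x by move=> e; apply: (mulgI x); rewrite mulgV sq.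
pose c := rho * tau.
have cr : c ^ rho = c^-1 by rewrite /c conjgE invMg !sqV // !mulgA sq // mul1g.
have ct : c ^ tau = c^-1 by rewrite /c conjgE invMg !sqV // -!mulgA sq // mulg1.
have nC : <[c]> <| G.
  rewrite /normal cycle_subG groupM //= defG gen_subG subUset !sub1set -!cycle_subG.
  by rewrite !norms_cycle cr ct groupV cycle_id.
have le_c : #|G| <= 2 * #[c].
  have sG : G \subset <[c]> * <[rho]>.
    have nr : <[rho]> \subset 'N(<[c]>) by rewrite cycle_subG (subsetP (normal_norm nC)).
    rewrite -norm_joinEr // {1}defG gen_subG subUset !sub1set.
    have Jr : rho \in <[c]> <*> <[rho]> by rewrite -cycle_subG joing_subr.
    have Jc : c \in <[c]> <*> <[rho]> by rewrite -cycle_subG joing_subl.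
    have -> : tau = rho * c by rewrite /c mulgA sq // mul1g.
    by rewrite Jr (groupM Jr Jc).
  apply: leq_trans (subset_leq_card sG) _.
  rewrite mulnC -order_rho [#[c]]/order [#[rho]]/order (mul_cardG <[c]> <[rho]>) leq_pmulr //.
have p_c : p %| #[c].
  have: #[c] %| #|G| by apply: order_dvdG; rewrite groupM.
  case/dvdnP=> m em; have m_le2 : m <= 2.
    by rewrite -(leq_pmul2r (order_gt0 c)) -em.
  have : p %| m * #[c] by rewrite -em c2 -mulnA dvdn_mulr.
  rewrite Euclid_dvdM // => /orP[pm|//].
  have m_gt0 : 0 < m by case: (m) em (cardG_gt0 G) => // ->.
  have := dvdn_leq m_gt0 pm; rewrite leqNgt (leq_ltn_trans m_le2) //.
  exact: odd_prime_gt2.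
pose P := <[c ^+ (#[c] %/ p)]>%G.
have cP : #|P| = p.
  by rewrite -[#|P|]/(#[_]) orderXdiv ?divnA ?dvdn_div // ?mulKn ?order_gt0.
exists P; split=> //; split=> //.
- by apply: char_normal_trans nC; apply: cycle_subgroup_char; apply: cycleX.
- exact: prime_abelem.
- by rewrite cP c2 mulnC [(p * r)%N]mulnC mulnA.
by rewrite -[rho ^+ 2]/(rho * rho) sq.
Qed.

Let proper_prime_trivial (P L : {group gT}) : #|P| = p -> L \proper P -> L :=: 1.
Proof.
move=> cP pL; rewrite -(setIidPr (proper_sub pL)); apply: prime_TIg; first by rewrite cP.
exact: proper_subn.
Qed.

Lemma cycle_distributive (P : {group gT}) : #|P| = p -> distributive_in G P.
Proof.
move=> cP A B L _ _ _ sA sB sL sAB LA LB; apply/eqP; case: eqVneq => // neL.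
have L1 : L :=: 1.
  by apply: (proper_prime_trivial cP); rewrite properEneq neL.
rewrite L1 !mul1g in LA LB sAB neL.
by move: sAB; rewrite LA LB setIid => /trivgP P1; rewrite P1 eqxx in neL.
Qed.

Lemma cycle_quotients (P L : {group gT}) : core p r G P rho tau -> #|P| = p ->
  L <| G -> L \proper P -> is_aug_PX p r (qdata G rho tau L).
Proof.
move=> cG cP nL pL; have sLP := proper_sub pL.
have L1 : L :=: 1 by apply: proper_prime_trivial cP pL.
have cQ := core_quotient odd_p cG nL sLP.
right; right.
apply: (rota_graph_iso_trivial_quotient (tl := id) (hd := @ordS (p * r))) isoD => //.
by split; [exact: core_gen cQ | exact: core_tau cQ].
Qed.
End Cycle.

Theorem theorem6p9 (p r : nat) (gT : finGroupType) (G : {group gT})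
    (rho tau : gT) :
  prime p -> odd p -> (3 <= r)%N -> ~~ (p %| r)%N ->
  is_rotary (RData G rho tau) -> is_aug_PX p r (RData G rho tau) ->
  exists (k : nat) (Ms : 'I_k -> rdata) (ds : 'I_k -> nat),
    [/\ (forall i, [/\ is_rotary (Ms i), is_aug_PX p r (Ms i)
                     & irred_d p r (ds i) (Ms i)]),
        cmap_iso (rota_cmap (RData G rho tau)) (prod_cmap Ms),
        (forall i j : 'I_k, i != j ->
           ~ cmap_iso (rota_cmap (Ms i)) (rota_cmap (Ms j))),
        (forall (k' : nat) (Ms' : 'I_k' -> rdata),
           (forall i, irreducible_aug_PX p r (Ms' i)) ->
           cmap_iso (rota_cmap (RData G rho tau)) (prod_cmap Ms') ->
           (forall i j : 'I_k', i != j ->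
              ~ cmap_iso (rota_cmap (Ms' i)) (rota_cmap (Ms' j))) ->
           exists sigma : 'I_k -> 'I_k',
             bijective sigma /\
             forall i, cmap_iso (rota_cmap (Ms i)) (rota_cmap (Ms' (sigma i)))) &
        exists N K : {group gT},
          [/\ (N ><| K = G)%g, (p.-abelem N)%g,
              #|N| = (p ^ (\sum_(i < k) ds i))%N & (K \isog 'D_(2 * r))%g]].
Proof.
move=> pr_p odd_p r_ge3 p_r rotD augD.
have of_PX s : rota_graph_iso (RData G rho tau) (@PXinc p r s) ->
    exists P : {group gT}, good p r G P rho tau by apply: PX_graph_good.
(* All quotient maps are augmented PX maps because [good] passes to quotients by proper [L] and
   determines the graph. *)
have of_good (P : {group gT}) : good p r G P rho tau -> _ := fun gG =>
  core_decomposition pr_p odd_p r_ge3 p_r (good_core gG) (good_nontrivial pr_p gG)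
    (good_distributive pr_p odd_p gG)
    (fun L nL pL => good_aug_PX pr_p odd_p r_ge3 p_r
       (good_quotient pr_p odd_p r_ge3 p_r gG nL pL)).
case: augD => [[s [_ /of_PX[P gP]]]|[/MC_PX0/of_PX[P gP]|isoC]]; [exact: of_good gP.. | ].
have [P [cG cP]] := cycle_core pr_p odd_p r_ge3 rotD isoC.
apply: (core_decomposition pr_p odd_p r_ge3 p_r cG).
- by rewrite -cardG_gt1 cP prime_gt1.
- exact: (cycle_distributive pr_p cP).
- by move=> L nL pL; apply: (cycle_quotients pr_p odd_p r_ge3 rotD isoC cG cP).
Qed.
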